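(* Let $\Omega=(a,b)\subset\mathbb{R}$ be a finite interval and $0<\alpha<1$. For each choice of sign $\pm$: suppose that $u\in L^p(\Omega)$ and ${}^{\pm}\mathcal{D}^{\alpha}u\in L^p(\Omega)$ for some $1\le p<\infty$. Then $$u=c_{\pm}^{1-\alpha}\,\kappa_{\pm}^{\alpha}+{}^{\pm}I^{\alpha}\,{}^{\pm}\mathcal{D}^{\alpha}u\qquad\text{a.e. in }\Omega.$$
   Context: Fractional integrals on $(a,b)$, for $\sigma>0$: ${}^{-}I^{\sigma}f(x)=\frac{1}{\Gamma(\sigma)}\int_a^x\frac{f(y)}{(x-y)^{1-\sigma}}\,dy$ and ${}^{+}I^{\sigma}f(x)=\frac{1}{\Gamma(\sigma)}\int_x^b\frac{f(y)}{(y-x)^{1-\sigma}}\,dy$. For $0<\alpha<1$: ${}^{-}D^{\alpha}\varphi=\frac{d}{dx}\,{}^{-}I^{1-\alpha}\varphi$ and ${}^{+}D^{\alpha}\varphi=-\frac{d}{dx}\,{}^{+}I^{1-\alpha}\varphi$. Weak fractional derivatives ($0<\alpha<1$): for $u\in L^1(\Omega)$, a function $v\in L^1_{loc}(\Omega)$ is the left (resp. right) weak fractional derivative of $u$, written $v={}^{-}\mathcal{D}^{\alpha}u$ (resp. $v={}^{+}\mathcal{D}^{\alpha}u$), if $\int_\Omega v\varphi\,dx=\int_\Omega u\,{}^{+}D^{\alpha}\varphi\,dx$ (resp. $\int_\Omega v\varphi\,dx=\int_\Omega u\,{}^{-}D^{\alpha}\varphi\,dx$) for all $\varphi\in C_0^\infty(\Omega)$.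 Kernel functions: $\kappa_-^{\alpha}(x)=(x-a)^{\alpha-1}$ and $\kappa_+^{\alpha}(x)=(b-x)^{\alpha-1}$. Constants: $c_-^{1-\alpha}=\frac{({}^{-}I^{1-\alpha}u)(a)}{\Gamma(\alpha)}$ and $c_+^{1-\alpha}=\frac{({}^{+}I^{1-\alpha}u)(b)}{\Gamma(\alpha)}$, where ${}^{\pm}I^{1-\alpha}u$ is identified with its absolutely continuous representative on $[a,b]$ in order to take the endpoint value. *)

(* Defs.v *)
From mathcomp Require Import all_boot all_order all_algebra.
From mathcomp Require Import all_classical all_reals all_analysis.

Set Implicit Arguments.
Unset Strict Implicit.
Unset Printing Implicit Defensive.

Import Order.TTheory GRing.Theory Num.Theory.
Import numFieldNormedType.Exports.

Local Open Scope classical_set_scope.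
Local Open Scope ring_scope.

(* Throughout, a function on the interval ]a, b[ is represented by a function
   R -> R of which only the values on ]a, b[ matter. *)

Section definitions.
Variable R : realType.
Implicit Types (a b p sigma alpha x : R) (f g u v phi : R -> R).

Local Notation mu := (@lebesgue_measure R).

Definition Gamma sigma : R :=
  \int[mu]_(t in `]0, +oo[) (t `^ (sigma - 1) * expR (- t)).

Definition frac_int_left a sigma f x : R :=
  (Gamma sigma)^-1 * \int[mu]_(y in `]a, x[) (f y / (x - y) `^ (1 - sigma)).

Definition frac_int_right b sigma f x : R :=
  (Gamma sigma)^-1 * \int[mu]_(y in `]x, b[) (f y / (y - x) `^ (1 - sigma)).

Definition frac_der_left a alpha phi x : R :=
  derive1 (frac_int_left a (1 - alpha) phi) x.

Definition frac_der_right b alpha phi x : R :=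
  - derive1 (frac_int_right b (1 - alpha) phi) x.

Definition in_Lp a b p f : Prop := (f \_ `]a, b[) \in Lfun mu p%:E.

(* The elements of C_0^oo(]a, b[), extended by 0 to R. *)
Definition test_function a b phi : Prop :=
  [/\ forall n x, derivable (derive1n n phi) x 1,
      compact (closure [set x | phi x != 0]) &
      closure [set x | phi x != 0] `<=` `]a, b[].

(* The left weak derivative is tested against right derivatives,
   and conversely. *)
Definition weak_frac_der_left a b alpha u v : Prop :=
  [/\ in_Lp a b 1 u, locally_integrable `]a, b[ v &
      forall phi, test_function a b phi ->
        \int[mu]_(x in `]a, b[) (v x * phi x) =
        \int[mu]_(x in `]a, b[) (u x * frac_der_right b alpha phi x)].

Definition weak_frac_der_right a b alpha u v : Prop :=
  [/\ in_Lp a b 1 u, locally_integrable `]a, b[ v &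
      forall phi, test_function a b phi ->
        \int[mu]_(x in `]a, b[) (v x * phi x) =
        \int[mu]_(x in `]a, b[) (u x * frac_der_left a alpha phi x)].

Definition kernel_left a alpha x : R := (x - a) `^ (alpha - 1).

Definition kernel_right b alpha x : R := (b - x) `^ (alpha - 1).

Definition absolutely_continuous a b g : Prop :=
  forall e : R, 0 < e -> exists2 d : R, 0 < d &
    forall n (l r : 'I_n -> R),
      (forall i, [/\ a <= l i, l i < r i & r i <= b]) ->
      trivIset setT (fun i => `]l i, r i[%classic) ->
      \sum_(i < n) (r i - l i) < d ->
      \sum_(i < n) `|g (r i) - g (l i)| < e.

Definition ac_representative a b f g : Prop :=
  absolutely_continuous a b g /\ ae_eq mu `]a, b[%classic f g.

End definitions.

(* Main.v *)
Require Import Defs.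
From mathcomp Require Import all_boot all_order all_algebra.
From mathcomp Require Import all_classical all_reals all_analysis.
From mathcomp Require Import measurable_realfun ring lra.

Set Implicit Arguments.
Unset Strict Implicit.
Unset Printing Implicit Defensive.

Import Order.TTheory GRing.Theory Num.Theory.
Import numFieldNormedType.Exports.

Local Open Scope classical_set_scope.
Local Open Scope ring_scope.

(* On ]a, b[ the left fractional integral of order s is the convolution with
   k_s(t) = t^(s-1) / Gamma(s), cut off outside ]0, b - a[.  By Fubini, v being
   the weak fractional derivative of u means that u * k_(1-alpha) has the ordinary
   weak derivative v, so it equals C + int_a^x v almost everywhere: the test
   functions with derivative e^-1 (bump((x-c)/e) - bump((x-d)/e)), e -> 0, compare
   the values of the difference at two Lebesgue points c and d.
   Convolving with k_alpha and using k_alpha * k_(1-alpha) = 1, which is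
   B(alpha, 1-alpha) = Gamma(alpha) Gamma(1-alpha), gives
   int_a^x u = int_a^x (C k_alpha(y-a) + (v * k_alpha)(y)) dy, and the claim
   follows by Lebesgue differentiation.  The right case is the left case for
   the functions reflected by x |-> a + b - x. *)

(** * Lebesgue integrals on the line and convolution *)

(** Since k_alpha * k_(1-alpha) is the constant 1 and not a Dirac mass, convolution alone does not
    invert the fractional integral: one ordinary differentiation remains. It is postponed to the
    very end because convolutions of integrable functions are controlled and associate only almost
    everywhere, and an integrated identity valid at almost every x still suffices to recover the
    integrands at Lebesgue points. The derivative of a test function has integral zero, so the weak
    identity cannot see an additive constant. It determines the convolution up to C, and C is
    identified only afterwards, as the value at the endpoint of any absolutely continuous
    representative. The power kernels are not integrable at infinity. Extension of u and v by zero
    together with the cut-off at b - a places every Fubini argument in L^1 of the whole line. *)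

Section affine_change.
Context {R : realType}.
Local Notation mu := (@lebesgue_measure R).
Implicit Types (c d : R).

Lemma measurable_affine c d :
  measurable_fun [set: R] (fun x : R => c * x + d).
Proof. by apply: measurable_funD => //; exact: measurable_funM. Qed.

(** The scaled pushforward is a measure that agrees with Lebesgue measure on the intervals []a, b]],
    and these values determine it. *)
Lemma lebesgue_measure_affine c d (A : set R) : 0 < c -> measurable A ->
  (c%:E * mu ((fun x : R => c * x + d)%R @^-1` A) = mu A)%E.
Proof.
move=> c0 mA.
pose phi : measurableTypeR R -> measurableTypeR R := fun x => c * x + d.
have mphi : measurable_fun setT phi by exact: measurable_affine.
pose P : {measure set (measurableTypeR R) -> \bar R} :=
  measure_function_pushforward__canonical__measure_function_Measure mu mphi.
pose nu := mscale (NngNum (ltW c0)) P.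
suff: mu A = nu A by [].
apply: lebesgue_measure_unique => // _ [[a b]] _ <-.
change (mu `]a, b]%classic = c%:E * mu (phi @^-1` `]a, b]%classic))%E.
have -> : phi @^-1` `]a, b]%classic = `](a - d) / c, (b - d) / c]%classic.
  apply/seteqP; split => x /=; rewrite !in_itv/= ltr_pdivrMr// ler_pdivlMr//.
    by rewrite /phi => /andP[? ?]; apply/andP; split; lra.
  by rewrite /phi => /andP[? ?]; apply/andP; split; lra.
rewrite !lebesgue_measure_itv/= !lte_fin ltr_pM2r ?invr_gt0// ltrD2r.
case: ifPn => ab; last by rewrite mule0.
rewrite -!EFinD -EFinM; congr EFin; field.
exact: lt0r_neq0.
Qed.

Local Open Scope ereal_scope.

Lemma ge0_integral_affine c d (f : R -> \bar R) : (0 < c)%R ->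
  measurable_fun setT f -> (forall x, 0 <= f x) ->
  c%:E * \int[mu]_x f (c * x + d)%R = \int[mu]_x f x.
Proof.
move=> c0 mf f0.
pose phi : measurableTypeR R -> measurableTypeR R := (fun x => c * x + d)%R.
have mphi : measurable_fun setT phi by exact: measurable_affine.
pose P : {measure set (measurableTypeR R) -> \bar R} :=
  measure_function_pushforward__canonical__measure_function_Measure mu mphi.
transitivity (\int[mscale (NngNum (ltW c0)) P]_x f x).
  rewrite ge0_integral_mscale//=.
  by rewrite [in RHS](@ge0_integral_pushforward _ _ _ _ _ _ mphi mu setT f)//=.
apply: eq_measure_integral => A mA _ /=.
by rewrite /mscale/= /pushforward/= lebesgue_measure_affine.
Qed.

Lemma ge0_integral_shift d (f : R -> \bar R) :
  measurable_fun setT f -> (forall x, 0 <= f x) ->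
  \int[mu]_x f (x + d)%R = \int[mu]_x f x.
Proof.
move=> mf f0; rewrite -[RHS](@ge0_integral_affine 1 d f)// mul1e.
by under [RHS]eq_integral do rewrite mul1r.
Qed.

(** The factor -1 is outside the range of [ge0_integral_affine]; it comes from the invariance of
    Lebesgue measure under negation, followed by a shift. *)
Lemma ge0_integral_reflect d (f : R -> \bar R) :
  measurable_fun setT f -> (forall x, 0 <= f x) ->
  \int[mu]_x f (d - x)%R = \int[mu]_x f x.
Proof.
move=> mf f0.
have mphi : measurable_fun setT (-%R : measurableTypeR R -> measurableTypeR R).
  exact: oppr_measurable.
transitivity (\int[pushforward mu (-%R : measurableTypeR R -> measurableTypeR R)]_x f (d + x)%R).
  rewrite (@ge0_integral_pushforward _ _ _ _ _ _ mphi mu)//=.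
  by apply: measurableT_comp => //; exact: measurable_funD.
transitivity (\int[mu]_x f (d + x)%R).
  by apply: eq_measure_integral => A mA _; exact: lebesgue_measureN.
rewrite -[RHS](ge0_integral_shift d mf f0).
by under eq_integral do rewrite addrC.
Qed.
End affine_change.

(** * Real-valued integrals over the whole line *)

Section real_integrals.
Context {R : realType}.
Local Notation mu := (@lebesgue_measure R).
Local Notation intg f := (mu.-integrable setT (EFin \o f)).
Implicit Types (f g h k : R -> R) (M d : R).

Lemma intg_measurable f : intg f -> measurable_fun setT f.
Proof. by move/measurable_int/measurable_EFinP. Qed.

Lemma intgP f : measurable_fun setT f ->
  (\int[mu]_x `|f x|%:E < +oo)%E -> intg f.
Proof.
by move=> mf fy; apply/integrableP; split => //; exact/measurable_EFinP.
Qed.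

Lemma intg_lty f : intg f -> (\int[mu]_x `|f x|%:E < +oo)%E.
Proof. by move=> /integrableP[]. Qed.

Lemma le_intg f g : measurable_fun setT f -> (forall x, `|f x| <= `|g x|) ->
  intg g -> intg f.
Proof.
move=> mf fg; apply: le_integrable => //; first exact/measurable_EFinP.
by move=> x _ /=; rewrite lee_fin.
Qed.

Lemma intgD f g : intg f -> intg g -> intg (fun x => f x + g x).
Proof. by move=> fi gi; exact: (integrableD measurableT fi gi). Qed.

Lemma intgB f g : intg f -> intg g -> intg (fun x => f x - g x).
Proof. by move=> fi gi; exact: (integrableB measurableT fi gi). Qed.

Lemma intgZ (r : R) f : intg f -> intg (fun x => r * f x).
Proof. by move=> fi; exact: (integrableZl measurableT r fi). Qed.

Lemma intgM_bounded f g M : measurable_fun setT g -> (forall x, `|g x| <= M) ->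
  intg f -> intg (fun x => g x * f x).
Proof.
move=> mg gM intf.
apply: (@le_intg _ (fun x => M * f x)).
- exact: measurable_funM (intg_measurable intf).
- by move=> x; rewrite !normrM ler_wpM2r// (le_trans (gM x))// ler_norm.
- by rewrite (_ : _ \o _ = fun x => M%:E * (f x)%:E)%E//; exact: integrableZl.
Qed.

Lemma ae_imply (P Q : R -> Prop) : (forall x, P x -> Q x) ->
  {ae mu, forall x, P x} -> {ae mu, forall x, Q x}.
Proof. by move=> PQ; apply: filterS; first exact: (ae_filter_ringOfSetsType mu). Qed.

Lemma ae_imply2 (P Q S : R -> Prop) : (forall x, P x -> Q x -> S x) ->
  {ae mu, forall x, P x} -> {ae mu, forall x, Q x} -> {ae mu, forall x, S x}.
Proof. by move=> PQS; apply: filterS2; first exact: (ae_filter_ringOfSetsType mu). Qed.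

(** The integral of the positive or of the negative part is infinite, so their difference is
    infinite too, the case [+oo - +oo] included, and [fine] maps it to 0. *)
Lemma fine_integral_nonintegrable f : measurable_fun setT f -> ~ intg f ->
  \int[mu]_x f x = 0.
Proof.
move=> mf nf; rewrite /Rintegral integralE.
set p := (X in (X - _)%E); set n := (X in (_ - X)%E).
have p0 : (0 <= p)%E by apply: integral_ge0.
have n0 : (0 <= n)%E by apply: integral_ge0.
have : ~ ((p < +oo)%E /\ (n < +oo)%E).
  move=> [py ny]; apply: nf; apply/integrableP; split.
    exact/measurable_EFinP.
  under eq_integral => x _ do rewrite -/((abse \o (EFin \o f)) x) fune_abse.
  rewrite ge0_integralD//=; first by rewrite lte_add_pinfty.
    by apply: measurable_funepos; exact/measurable_EFinP.
  by apply: measurable_funeneg; exact/measurable_EFinP.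
move: p n p0 n0 => [p| |] [n| |]//= _ _.
by move=> H; exfalso; apply: H; rewrite !ltry.
Qed.

(* No integrability is needed: when f is measurable but not integrable, both
   sides are 0, since fine maps the infinite integrals to 0. *)
Lemma RintegralZlT (r : R) f : measurable_fun setT f ->
  \int[mu]_x (r * f x) = r * \int[mu]_x f x.
Proof.
move=> mf; have [intf|nf] := pselect (intg f); first by rewrite RintegralZl.
have [->|r0] := eqVneq r 0.
  by under eq_Rintegral do rewrite mul0r; rewrite Rintegral_cst// !mul0r.
rewrite (fine_integral_nonintegrable mf nf) mulr0 fine_integral_nonintegrable//.
  exact: measurable_funM.
move=> intrf; apply: nf.
rewrite (_ : _ \o _ = fun x => r^-1%:E * (r * f x)%:E)%E; first exact: integrableZl.
by apply/funext => x /=; rewrite -EFinM mulKf.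
Qed.

Lemma RintegralZrT (r : R) f : measurable_fun setT f ->
  \int[mu]_x (f x * r) = (\int[mu]_x f x) * r.
Proof.
by move=> mf; under eq_Rintegral do rewrite mulrC; rewrite RintegralZlT// mulrC.
Qed.

Lemma ae_eq_Rintegral f g : measurable_fun setT f -> measurable_fun setT g ->
  {ae mu, forall x, f x = g x} -> \int[mu]_x f x = \int[mu]_x g x.
Proof.
move=> mf mg fg; congr fine; apply: ae_eq_integral => //.
- exact/measurable_EFinP.
- exact/measurable_EFinP.
- by apply: ae_imply fg => x -> _.
Qed.

Lemma Rintegral_shift d f : measurable_fun setT f ->
  \int[mu]_x f (x + d) = \int[mu]_x f x.
Proof.
move=> mf; congr fine; have mf' : measurable_fun setT (EFin \o f).
  exact/measurable_EFinP.
rewrite integralE [RHS]integralE; congr (_ - _)%E.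
- rewrite -[RHS](ge0_integral_shift d (measurable_funepos mf'))//.
  by apply: eq_integral => x _; rewrite ?funeposE ?funenegE.
- rewrite -[RHS](ge0_integral_shift d (measurable_funeneg mf'))//.
  by apply: eq_integral => x _; rewrite ?funeposE ?funenegE.
Qed.

Lemma Rintegral_reflect d f : measurable_fun setT f ->
  \int[mu]_x f (d - x) = \int[mu]_x f x.
Proof.
move=> mf; congr fine; have mf' : measurable_fun setT (EFin \o f).
  exact/measurable_EFinP.
rewrite integralE [RHS]integralE; congr (_ - _)%E.
- rewrite -[RHS](ge0_integral_reflect d (measurable_funepos mf'))//.
  by apply: eq_integral => x _; rewrite ?funeposE ?funenegE.
- rewrite -[RHS](ge0_integral_reflect d (measurable_funeneg mf'))//.
  by apply: eq_integral => x _; rewrite ?funeposE ?funenegE.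
Qed.

Lemma measurable_shift d f : measurable_fun setT f ->
  measurable_fun setT (fun x : R => f (x + d)).
Proof.
move=> mf; apply: (measurableT_comp mf).
by apply: measurable_funD => //; exact: measurable_id.
Qed.

Lemma measurable_reflect d f : measurable_fun setT f ->
  measurable_fun setT (fun x : R => f (d - x)).
Proof.
move=> mf; apply: (measurableT_comp mf).
by apply: measurable_funB => //; exact: measurable_id.
Qed.

Lemma intg_shift d f : intg f -> intg (fun x : R => f (x + d)).
Proof.
move=> intf; have mf := intg_measurable intf.
apply: intgP; first exact: measurable_shift.
rewrite (ge0_integral_shift d (f := fun x => `|f x|%:E))//; first exact: intg_lty.
by apply/measurable_EFinP; exact: measurableT_comp.
Qed.

Lemma intg_reflect d f : intg f -> intg (fun x : R => f (d - x)).
Proof.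
move=> intf; have mf := intg_measurable intf.
apply: intgP; first exact: measurable_reflect.
rewrite (ge0_integral_reflect d (f := fun x => `|f x|%:E))//; first exact: intg_lty.
by apply/measurable_EFinP; exact: measurableT_comp.
Qed.

(** The inner extended-real integrals are finite only almost everywhere. Applying [fine] alters them
    on a null set, which affects neither integrability nor the outer integral. *)
Lemma RFubini (F : R * R -> R) :
  (mu \x mu)%E.-integrable setT (EFin \o F) ->
  [/\ intg (fun x => \int[mu]_y F (x, y)), intg (fun y => \int[mu]_x F (x, y)) &
      \int[mu]_x \int[mu]_y F (x, y) = \int[mu]_y \int[mu]_x F (x, y)].
Proof.
move=> iF.
have key (G : R -> \bar R) : mu.-integrable setT G ->
    intg (fine \o G) /\ \int[mu]_x fine (G x) = fine (\int[mu]_x G x).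
  move=> iG.
  have mG : measurable_fun setT G by exact: measurable_int iG.
  have mfG : measurable_fun setT (fine \o G).
    by apply: measurableT_comp => //; exact: fine_measurable.
  have GE : {ae mu, forall x, (fine (G x))%:E = G x}.
    by apply: ae_imply (integrable_ae measurableT iG) => x /= /(_ I) /fineK.
  split.
    apply: (le_integrable measurableT _ _ iG).
      exact/measurable_EFinP.
    move=> x _ /=; case: (G x) => //= ; rewrite ?normr0 ?lee_fin//.
      by rewrite leey.
    by rewrite leey.
  congr fine; apply: ae_eq_integral => //; first exact/measurable_EFinP.
  by apply: ae_imply GE => x /= -> _.
have [i1 e1] := key _ (integrable_fubini_F iF).
have mF : measurable_fun setT (EFin \o F) by exact: measurable_int iF.
have maF : measurable_fun setT (abse \o (EFin \o F)) by exact: measurableT_comp.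
have iG : mu.-integrable setT (fubini_G mu (EFin \o F)).
  apply/integrableP; split; first exact: (measurable_fubini_G iF).
  apply: le_lt_trans ((integrable21ltyP mu mu mF).1 iF).
  apply: ge0_le_integral => //.
  - by apply: measurableT_comp => //; exact: (measurable_fubini_G iF).
  - apply: (measurable_fun_fubini_tonelli_G (m1 := mu) _ maF) => z.
    exact: abse_ge0.
  - move=> y _; apply: le_abse_integral => //.
    exact: measurable_fun_pair1.
have [i2 e2] := key _ iG.
by split => //; rewrite e1 e2; congr fine; exact: (Fubini iF).
Qed.

End real_integrals.

(** * Convolution of integrable functions *)

Section convolution.
Context {R : realType}.
Local Notation mu := (@lebesgue_measure R).
Local Notation intg f := (mu.-integrable setT (EFin \o f)).
Implicit Types (f g h k l : R -> R) (M d : R).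

(** For measurable f and k the value is 0 wherever the integrand is not integrable. Commutativity
    therefore holds at every point, whereas additivity and associativity are claimed almost
    everywhere. *)
Definition conv f k x := \int[mu]_y (f y * k (x - y)).

Lemma measurable_conv_integrand f k :
  measurable_fun setT f -> measurable_fun setT k ->
  measurable_fun [set: R * R] (fun z : R * R => f z.2 * k (z.1 - z.2)).
Proof.
move=> mf mk; apply: measurable_funM.
  exact: (measurableT_comp mf measurable_snd).
apply: (measurableT_comp mk).
by apply: measurable_funB; [exact: measurable_fst|exact: measurable_snd].
Qed.

(** With the integration in x done first, translation invariance turns the inner integral of the
    absolute value into |f y| times the L^1 norm of k; the total is the product of the two norms. *)
Lemma integrable_conv_integrand f k : intg f -> intg k ->
  (mu \x mu)%E.-integrable setT
    (EFin \o (fun z : R * R => f z.2 * k (z.1 - z.2))).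
Proof.
move=> intf intk.
have [mf mk] := (intg_measurable intf, intg_measurable intk).
have m := measurable_conv_integrand mf mk.
apply/integrable21ltyP; first exact/measurable_EFinP.
under eq_integral => y _.
  under eq_integral => x _.
    rewrite /= normrM EFinM; over.
  rewrite ge0_integralZl//; last first.
    apply/measurable_EFinP; apply: measurableT_comp => //.
    exact: (measurable_shift (- y) mk).
  rewrite (ge0_integral_shift (- y) (f := fun x => `|k x|%:E))//; last first.
    by apply/measurable_EFinP; exact: measurableT_comp.
  over.
rewrite ge0_integralZr//; last 2 first.
- by apply/measurable_EFinP; exact: measurableT_comp.
- exact: integral_ge0.
rewrite lte_mul_pinfty//.
- exact: integral_ge0.
- by rewrite ge0_fin_numE ?integral_ge0//; exact: intg_lty.
- exact: intg_lty.
Qed.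

Lemma intg_conv f k : intg f -> intg k -> intg (conv f k).
Proof.
by move=> intf intk; have [] := RFubini (integrable_conv_integrand intf intk).
Qed.

Lemma convC f k x : measurable_fun setT f -> measurable_fun setT k ->
  conv f k x = conv k f x.
Proof.
move=> mf mk; rewrite /conv -(Rintegral_reflect x); last first.
  by apply: measurable_funM => //; exact: measurable_reflect.
by apply: eq_Rintegral => y _; rewrite subKr mulrC.
Qed.

(** Fubini, the integrand being dominated by M |f y k (x - y)|. It is used with G the derivative of
    a test function, to move the kernel from the test function to f. *)
Lemma conv_dual f k (G : R -> R) (M : R) : intg f -> intg k ->
  measurable_fun setT G -> (forall x, `|G x| <= M) ->
  intg (fun y => f y * \int[mu]_x (G x * k (x - y))) /\
  \int[mu]_x (G x * conv f k x) = \int[mu]_y (f y * \int[mu]_x (G x * k (x - y))).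
Proof.
move=> intf intk mG GM.
have [mf mk] := (intg_measurable intf, intg_measurable intk).
pose F (z : R * R) := G z.1 * (f z.2 * k (z.1 - z.2)).
have iF : (mu \x mu)%E.-integrable setT (EFin \o F).
  have := integrableZl measurableT M (integrable_conv_integrand intf intk).
  apply: le_integrable => //.
    apply/measurable_EFinP; apply: measurable_funM.
      exact: (measurableT_comp mG measurable_fst).
    exact: measurable_conv_integrand.
  move=> z _ /=; rewrite lee_fin /F normrM [leRHS]normrM ler_wpM2r//.
  by rewrite (le_trans (GM _))// ler_norm.
have [_ iy FE] := RFubini iF.
have Fy : (fun y => \int[mu]_x F (x, y)) = (fun y => f y * \int[mu]_x (G x * k (x - y))).
  apply/funext => y; rewrite /F/=.
  rewrite -RintegralZlT; last by apply: measurable_funM => //; exact: (measurable_shift (- y)).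
  by apply: eq_Rintegral => x _; rewrite mulrCA.
rewrite -Fy; split => //; rewrite -FE.
apply: eq_Rintegral => x _; rewrite /F/= RintegralZlT//.
by apply: measurable_funM => //; exact: measurable_reflect.
Qed.

(* Only almost everywhere: Fubini needs the triple integrand at x to be integrable,
   and the double integral of its absolute value is finite for almost every x. *)
Lemma convA f k l : intg f -> intg k -> intg l ->
  {ae mu, forall x, conv (conv f k) l x = conv f (conv k l) x}.
Proof.
move=> intf intk intl.
have [mf mk ml] := And3 (intg_measurable intf) (intg_measurable intk) (intg_measurable intl).
have mfk := measurable_conv_integrand mf mk.
have ifk := integrable_conv_integrand intf intk.
pose A y := (\int[mu]_z `|f z * k (y - z)|%:E)%E.
have A0 y : (0 <= A y)%E by apply: integral_ge0.
have mA : measurable_fun setT A.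
  apply: (measurable_fun_fubini_tonelli_F (m2 := mu)
    (fun z : R * R => `|f z.2 * k (z.1 - z.2)|%:E)) => //.
  by apply/measurable_EFinP; exact: measurableT_comp.
have Ay : (\int[mu]_y A y < +oo)%E.
  exact: ((integrable12ltyP mu mu (measurable_int _ ifk)).1 ifk).
pose B (z : R * R) := (A z.2 * `|l (z.1 - z.2)|%:E)%E.
have mB : measurable_fun setT B.
  apply: emeasurable_funM; first exact: (measurableT_comp mA measurable_snd).
  apply/measurable_EFinP; apply: measurableT_comp => //; apply: (measurableT_comp ml).
  by apply: measurable_funB; [exact: measurable_fst|exact: measurable_snd].
have B0 z : (0 <= B z)%E by rewrite mule_ge0.
have iH : mu.-integrable setT (fun x => \int[mu]_y B (x, y))%E.
  apply/integrableP; split; first exact: (measurable_fun_fubini_tonelli_F (m2 := mu)).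
  under eq_integral do rewrite gee0_abs ?integral_ge0//.
  rewrite (fubini_tonelli (m1 := mu) (m2 := mu) B)//.
  under eq_integral => y _.
    rewrite /B/= ge0_integralZl//; last first.
      apply/measurable_EFinP; apply: measurableT_comp => //.
      exact: (measurable_shift (- y) ml).
    rewrite (ge0_integral_shift (- y) (f := fun x => `|l x|%:E))//; last first.
      by apply/measurable_EFinP; exact: measurableT_comp.
    over.
  rewrite ge0_integralZr//; last exact: integral_ge0.
  rewrite lte_mul_pinfty//.
  - exact: integral_ge0.
  - by rewrite ge0_fin_numE ?integral_ge0//; exact: intg_lty.
  - exact: intg_lty.
apply: ae_imply (integrable_ae measurableT iH) => x /= /(_ I) Hx.
pose F (z : R * R) := f z.2 * k (z.1 - z.2) * l (x - z.1).
have mF : measurable_fun setT F.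
  apply: measurable_funM => //; apply: (measurableT_comp ml).
  by apply: measurable_funB => //; exact: measurable_fst.
have EB : (\int[mu]_y \int[mu]_z `|(F (y, z))%:E| = \int[mu]_y B (x, y))%E.
  apply: eq_integral => y _; rewrite /B/= /A -ge0_integralZr//.
    by apply: eq_integral => z _; rewrite /F/= normrM EFinM.
  apply/measurable_EFinP; apply: measurableT_comp => //.
  by apply: measurable_funM => //; exact: measurable_reflect.
have iF : (mu \x mu)%E.-integrable setT (EFin \o F).
  apply/integrable12ltyP; first exact/measurable_EFinP.
  apply: le_lt_trans (_ : (\int[mu]_y B (x, y) < +oo)%E); first by rewrite -EB.
  by rewrite -ge0_fin_numE// integral_ge0.
have [_ _ FE] := RFubini iF.
transitivity (\int[mu]_y \int[mu]_z F (y, z)).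
  apply: eq_Rintegral => y _; rewrite /F/= RintegralZrT//.
  by apply: measurable_funM => //; exact: measurable_reflect.
rewrite FE; apply: eq_Rintegral => z _; rewrite /F/=.
under eq_Rintegral do rewrite -mulrA.
rewrite RintegralZlT; last first.
  by apply: measurable_funM; [exact: (measurable_shift (- z))|exact: measurable_reflect].
congr (_ * _); rewrite -(Rintegral_shift z); last first.
  by apply: measurable_funM; [exact: (measurable_shift (- z))|exact: measurable_reflect].
by apply: eq_Rintegral => y _; congr (k _ * l _); ring.
Qed.

End convolution.

(** * Power kernels, Gamma and Beta *)

Section power_kernel.
Context {R : realType}.
Local Notation mu := (@lebesgue_measure R).
Local Notation intg f := (mu.-integrable setT (EFin \o f)).
Implicit Types (s t r e B alpha : R).

(** The one-sided power: its vanishing for t <= 0 makes the convolution at x depend only on values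
    to the left of x. *)
Definition pker s t : R := if 0 < t then t `^ (s - 1) else 0.

Lemma pker_ge0 s t : 0 <= pker s t.
Proof. by rewrite /pker; case: ifPn => // _; exact: powR_ge0. Qed.

Lemma measurable_pker s : measurable_fun setT (pker s).
Proof.
apply: measurable_fun_ifT => //.
by apply: (measurable_fun_ltr (f := cst 0) (g := id)).
Qed.

Lemma pkerM s r t : 0 < r -> pker s (r * t) = r `^ (s - 1) * pker s t.
Proof.
move=> r0; rewrite /pker pmulr_rgt0//; case: ifPn => t0; last by rewrite mulr0.
by rewrite powRM// ltW.
Qed.

Lemma integral_powR_itv s e B : 0 < s -> 0 < e -> e < B ->
  (\int[mu]_(t in `[e, B]) (t `^ (s - 1))%:E = (B `^ s / s - e `^ s / s)%:E)%E.
Proof.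
move=> s0 e0 eB.
have cpow r (x : R) : 0 < x -> {for x, continuous (fun t : R => t `^ r)}.
  move=> x0; apply: differentiable_continuous; apply/derivable1_diffP.
  by apply: derivable_powR; rewrite in_itv/= x0.
have der (x : R) : 0 < x -> is_derive x 1 (fun t : R => t `^ s / s) (x `^ (s - 1)).
  move=> x0; have := is_derive1_powR s x0 => dp.
  rewrite (_ : (fun t => _) = (fun t => s^-1 *: t `^ s)); last first.
    by apply/funext => t; rewrite /GRing.scale/= mulrC.
  apply: is_derive_eq.
  by rewrite /GRing.scale/= mulrA mulVf ?mul1r// gt_eqF.
rewrite (@continuous_FTC2 _ (fun t => t `^ (s - 1)) (fun t => t `^ s / s))//.
- apply: continuous_in_subspaceT => x.
  rewrite inE/= in_itv/= => /andP[ex _].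
  exact/cpow/(lt_le_trans e0).
- split.
  + move=> x; rewrite in_itv/= => /andP[ex _].
    by have := der x (lt_trans e0 ex); case.
  + apply: cvg_at_right_filter; apply: cvgM; last exact: cvg_cst.
    exact: cpow.
  + apply: cvg_at_left_filter; apply: cvgM; last exact: cvg_cst.
    by apply: cpow; exact: lt_trans eB.
- move=> x; rewrite in_itv/= => /andP[ex _].
  have := der x (lt_trans e0 ex) => ?.
  by rewrite derive1E derive_val.
Qed.

(** For s < 1 the integrand is singular at 0, so the interval is exhausted by compact ones, on which
    the integral is at most B^s / s. *)
Lemma integral_powR_lty s B : 0 < s -> 0 < B ->
  (\int[mu]_(t in `]0%R, B]) (t `^ (s - 1))%:E < +oo)%E.
Proof.
move=> s0 B0.
(* The offset 2 keeps the left end strictly below B already for n = 0. *)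
pose E n : set R := `[B / n.+2%:R, B]%classic.
have -> : `]0%R, B]%classic = \bigcup_n E n.
  apply/seteqP; split => [x|x [n _]].
    rewrite /= in_itv/= => /andP[x0 xB].
    exists (Num.bound (B / x)) => //; rewrite /E/= in_itv/= xB andbT.
    rewrite ler_pdivrMr// mulrC -ler_pdivrMr//.
    rewrite (le_trans (ltW (archi_boundP _)))//; first by rewrite divr_ge0// ltW.
    by rewrite ler_nat -addn2 leq_addr.
  rewrite /E/= !in_itv/= => /andP[nx ->]; rewrite andbT.
  by rewrite (lt_le_trans _ nx)// divr_gt0.
have mE i : measurable (E i) by exact: measurable_itv.
have ndE : nondecreasing_seq E.
  apply/nondecreasing_seqP => n; rewrite subsetEset => x; rewrite /E/= !in_itv/=.
  move=> /andP[nx ->]; rewrite andbT (le_trans _ nx)//.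
  by rewrite ler_pM2l// lef_pV2 ?posrE// ler_nat.
have mp i : measurable_fun (E i) (fun t => (t `^ (s - 1))%:E).
  by apply/measurable_EFinP; apply: measurable_funTS; exact: (@measurable_powR R (s - 1)).
have p0 (i : nat) x : E i x -> (0 <= (x `^ (s - 1))%:E)%E.
  by move=> _; rewrite lee_fin powR_ge0.
have /cvg_lim <- // := ge0_nondecreasing_set_cvg_integral (mu := mu) ndE mE mp p0.
apply: (@le_lt_trans _ _ (B `^ s / s)%:E); last exact: ltry.
apply: lime_le.
  apply: ereal_nondecreasing_is_cvgn.
  exact: ge0_nondecreasing_set_nondecreasing_integral.
exists 0 => // n _ /=; rewrite integral_powR_itv//.
- by rewrite lee_fin lerBlDr lerDl divr_ge0 ?powR_ge0// ltW.
- by rewrite divr_gt0.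
- by rewrite ltr_pdivrMr// ltr_pMr// ltr1n.
Qed.

Definition trunc_pker s B t : R := if t < B then pker s t else 0.

Lemma measurable_trunc_pker s B : measurable_fun setT (trunc_pker s B).
Proof.
apply: measurable_fun_ifT => //; last exact: measurable_pker.
by apply: (measurable_fun_ltr (f := id) (g := cst B)).
Qed.

Lemma intg_trunc_pker s B : 0 < s -> 0 < B -> intg (trunc_pker s B).
Proof.
move=> s0 B0; apply: intgP; first exact: measurable_trunc_pker.
apply: le_lt_trans (integral_powR_lty s0 B0).
rewrite [leRHS]integral_mkcond; apply: ge0_le_integral => //.
- by apply/measurable_EFinP; apply: measurableT_comp => //; exact: measurable_trunc_pker.
- apply/(measurable_restrictT _ _).1 => //.
  by apply/measurable_EFinP; apply: measurable_funTS; exact: (@measurable_powR R (s - 1)).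
- move=> t _; rewrite patchE /trunc_pker /pker; case: ifPn => tB; last first.
    by rewrite normr0; case: ifPn => // _; rewrite lee_fin powR_ge0.
  case: ifPn => t0; last first.
    by rewrite normr0; case: ifPn => // _; rewrite lee_fin powR_ge0.
  by rewrite mem_set ?ger0_norm ?powR_ge0//= in_itv/= t0 ltW.
Qed.

End power_kernel.

(** * The Gamma function and the Beta integral B(alpha, 1 - alpha) *)

Section gamma_beta.
Context {R : realType}.
Local Notation mu := (@lebesgue_measure R).
Local Notation intg f := (mu.-integrable setT (EFin \o f)).
Implicit Types (s t r B alpha : R).

Lemma measurable_gamma_integrand s :
  measurable_fun setT (fun t => pker s t * expR (- t)).
Proof.
apply: measurable_funM; first exact: measurable_pker.
by apply: measurableT_comp => //; exact: oppr_measurable.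
Qed.

Lemma integral_expRN :
  (\int[mu]_(t in `]0%R, +oo[) (expR (- t))%:E = 1)%E.
Proof.
rewrite -(integral_exponential_pdf (@ltr01 R)).
rewrite integral_itv_obnd_cbnd; last first.
  apply/measurable_EFinP; apply: measurable_funTS.
  by apply: measurableT_comp => //; exact: oppr_measurable.
rewrite integral_mkcond; apply: eq_integral => x _.
rewrite /exponential_pdf !patchE; case: ifP => //.
by rewrite mul1r mulN1r.
Qed.

(** For 0 < t < 2 the exponential is at most 1; for t >= 2 the power is at most 1 because s <= 1.
    Any cut-off that is at least 1 would serve in place of 2. *)
Lemma intg_gamma_integrand s : 0 < s -> s <= 1 ->
  intg (fun t => pker s t * expR (- t)).
Proof.
move=> s0 s1.
apply: (@le_intg _ _ (fun t => trunc_pker s 2 t + exponential_pdf 1 t)).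
- exact: measurable_gamma_integrand.
- move=> t; have e0 : 0 <= exponential_pdf 1 t :> R by exact: exponential_pdf_ge0.
  have p0 : 0 <= trunc_pker s 2 t.
    by rewrite /trunc_pker; case: ifPn => // _; exact: pker_ge0.
  rewrite ger0_norm ?mulr_ge0 ?pker_ge0 ?expR_ge0// ger0_norm ?addr_ge0//.
  have [t0|t0] := leP t 0.
    by rewrite {1}/pker ltNge t0/= mul0r addr_ge0.
  rewrite /trunc_pker (exponential_pdfE _ (ltW t0)) mul1r mulN1r.
  case: ifPn => t2.
    rewrite -[leLHS]addr0 lerD ?expR_ge0//.
    by rewrite ler_piMr ?pker_ge0// expR_le1 oppr_le0 ltW.
  rewrite add0r ler_piMl ?expR_ge0// /pker t0.
  have t1 : 1 <= t by rewrite (le_trans _ (_ : 2 <= t)) ?ler1n// leNgt.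
  by rewrite -[leRHS](powRr0 t) ler_powR// subr_le0.
- rewrite (_ : _ \o _ = (EFin \o trunc_pker s 2) \+ (EFin \o exponential_pdf 1))%E//.
  apply: integrableD => //; first exact: intg_trunc_pker.
  exact: integrable_exponential_pdf.
Qed.

Lemma GammaE s : 0 < s -> s <= 1 ->
  ((Gamma s)%:E = \int[mu]_t (pker s t * expR (- t))%:E)%E.
Proof.
move=> s0 s1; have ig := intg_gamma_integrand s0 s1.
rewrite -[RHS]fineK; last exact: integrable_fin_num ig.
congr EFin; rewrite /Gamma Rintegral_mkcond; apply: eq_Rintegral => t _.
rewrite patchE /pker; case: ifPn.
  by rewrite inE/= in_itv/= andbT => ->.
by rewrite notin_setE/= in_itv/= andbT => /negP/negbTE ->; rewrite mul0r.
Qed.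

(** On []0, 1]] the power is at least 1, as s <= 1, and the exponential at least [expR (-1)]. *)
Lemma Gamma_gt0 s : 0 < s -> s <= 1 -> 0 < Gamma s.
Proof.
move=> s0 s1; rewrite -lte_fin GammaE//.
apply: (@lt_le_trans _ _ (\int[mu]_(t in `]0%R, 1%R]) (expR (-1))%:E)%E).
  rewrite integral_cst//= lebesgue_measure_itv/= lte_fin ltr01 sube0 mule1.
  by rewrite lte_fin expR_gt0.
rewrite integral_mkcond; apply: ge0_le_integral => //.
- by move=> t _; rewrite patchE; case: ifPn => // _; rewrite lee_fin expR_ge0.
- by apply/(measurable_restrictT _ _).1.
- by apply/measurable_EFinP; exact: measurable_gamma_integrand.
- move=> t _; rewrite patchE /pker; case: ifPn.
    rewrite inE/= in_itv/= => /andP[t0 t1]; rewrite t0 lee_fin.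
    apply: (@le_trans _ _ (expR (- t))); first by rewrite ler_expR lerN2.
    rewrite ler_peMl ?expR_ge0// -[leLHS](powRr0 t) ger_powR ?t0//.
    by rewrite subr_le0.
  by move=> _; case: ifPn => _; rewrite ?mul0r// lee_fin mulr_ge0 ?powR_ge0 ?expR_ge0.
Qed.

Local Open Scope ereal_scope.

Let beta alpha r : \bar R :=
  \int[mu]_t (pker alpha t * pker (1 - alpha) (r - t))%:E.

Let measurable_beta_integrand alpha r :
  measurable_fun setT (fun t => (pker alpha t * pker (1 - alpha) (r - t))%:E).
Proof.
apply/measurable_EFinP; apply: measurable_funM; first exact: measurable_pker.
by apply: measurable_reflect; exact: measurable_pker.
Qed.

(** The substitution of r t for t produces the factor r r^(alpha - 1) r^(- alpha) = 1. *)
Let betaE alpha r : (0 < r)%R -> beta alpha r = beta alpha 1.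
Proof.
move=> r0; rewrite /beta -(@ge0_integral_affine _ r 0 (fun t => _))//; last first.
  by move=> t; rewrite lee_fin mulr_ge0 ?pker_ge0.
rewrite -ge0_integralZl//; first last.
- by rewrite lee_fin ltW.
- by move=> t _; rewrite lee_fin mulr_ge0 ?pker_ge0.
- apply/measurable_EFinP; apply: measurable_funM.
    by apply: (measurableT_comp (measurable_pker _)); exact: measurable_affine.
  apply: (measurableT_comp (measurable_pker _)).
  by apply: measurable_funB => //; exact: measurable_affine.
apply: eq_integral => t _; rewrite addr0.
have -> : (r - r * t = r * (1 - t))%R by ring.
rewrite !pkerM// -EFinM; congr EFin.
transitivity ((r * (r `^ (alpha - 1) * r `^ (1 - alpha - 1))) *
  (pker alpha t * pker (1 - alpha) (1 - t)))%R; first by ring.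
rewrite -powRD; last by rewrite (gt_eqF r0) implybT.
have -> : (alpha - 1 + (1 - alpha - 1) = -1)%R by ring.
by rewrite powR_inv1 ?ltW// mulfV ?gt_eqF// mul1r.
Qed.

(* The double integral defining Gamma(alpha) Gamma(1 - alpha), sliced along the
   lines s + t = r: by homogeneity the inner integral does not depend on r. *)
Lemma beta_complement alpha r : (0 < alpha < 1)%R -> (0 < r)%R ->
  \int[mu]_t (pker alpha t * pker (1 - alpha) (r - t))%:E =
  (Gamma alpha * Gamma (1 - alpha))%:E.
Proof.
move=> /andP[a0 a1] r0; rewrite -/(beta alpha r) betaE//.
pose A t := (pker alpha t * expR (- t))%R.
pose C t := (pker (1 - alpha) t * expR (- t))%R.
have mA : measurable_fun setT A by exact: measurable_gamma_integrand.
have mC : measurable_fun setT C by exact: measurable_gamma_integrand.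
have A0 t : (0 <= A t)%R by rewrite mulr_ge0 ?pker_ge0 ?expR_ge0.
have C0 t : (0 <= C t)%R by rewrite mulr_ge0 ?pker_ge0 ?expR_ge0.
have b0 : 0 <= beta alpha 1.
  by apply: integral_ge0 => t _; rewrite lee_fin mulr_ge0 ?pker_ge0.
rewrite EFinM GammaE ?ltW// GammaE ?subr_gt0 ?gerBl ?ltW//.
rewrite -/A -ge0_integralZr//; first last.
- by apply: integral_ge0 => t _; rewrite lee_fin; exact: C0.
- by move=> t _; rewrite lee_fin; exact: A0.
- exact/measurable_EFinP.
pose F (z : R * R) := (A z.2 * C (z.1 - z.2))%:E.
transitivity (\int[mu]_t \int[mu]_r F (r, t)); last first.
  apply: eq_integral => t _; rewrite /F/=.
  rewrite -[in RHS](ge0_integral_shift (- t) (f := fun x => (C x)%:E))//; last first.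
    exact/measurable_EFinP.
  rewrite -ge0_integralZl//.
  - by apply/measurable_EFinP; exact: measurable_shift.
  - by move=> u _; rewrite lee_fin; exact: C0.
  - by rewrite lee_fin; exact: A0.
rewrite -(fubini_tonelli (m1 := mu) (m2 := mu) F); first last.
- by move=> z; rewrite lee_fin mulr_ge0.
- by apply/measurable_EFinP; exact: measurable_conv_integrand.
(* The factor 1 is written as the integral of exp(- u) over u > 0, so both sides are integrals in u.
   They are compared slice by slice: the slice at u > 0 is exp(- u) [beta alpha u], and for u <= 0
   it vanishes. *)
rewrite -[LHS]mul1e -integral_expRN -ge0_integralZr//; last first.
  apply/measurable_EFinP; apply: measurable_funTS.
  by apply: measurableT_comp => //; exact: oppr_measurable.
rewrite integral_mkcond; apply: eq_integral => u _; rewrite patchE.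
case: ifPn; rewrite ?inE ?notin_setE/= in_itv/= andbT => u0.
  rewrite -(betaE alpha u0) /beta -ge0_integralZl//; last first.
  - by move=> t _; rewrite lee_fin mulr_ge0 ?pker_ge0.
  - exact: measurable_beta_integrand.
  apply: eq_integral => t _; rewrite -EFinM /F/A/C/=; congr EFin.
  rewrite [RHS]mulrACA -expRD mulrC; congr (_ * expR _)%R; ring.
rewrite integral0_eq// => t _; rewrite /F/A/C/pker/=.
have [t0|t0] := ltP 0%R t; last by rewrite !mul0r.
rewrite ifF ?mul0r ?mulr0//; apply/negbTE; rewrite subr_gt0 -leNgt.
by rewrite (le_trans _ (ltW t0))// leNgt; apply/negP.
Qed.

End gamma_beta.

(** * The normalized, truncated kernels of fractional integration *)

Section normalized_kernel.
Context {R : realType}.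
Local Notation mu := (@lebesgue_measure R).
Local Notation intg f := (mu.-integrable setT (EFin \o f)).
Implicit Types (s t r B alpha : R).

(* The cut-off at B makes the kernel integrable; with B = b - a it does not affect
   convolution, on ]a, b[, with functions supported in ]a, b[. *)
Definition nker s B t := (Gamma s)^-1 * trunc_pker s B t.

Lemma intg_nker s B : 0 < s -> 0 < B -> intg (nker s B).
Proof.
move=> s0 B0.
rewrite (_ : _ \o _ = fun t => (Gamma s)^-1%:E * (trunc_pker s B t)%:E)%E//.
by apply: integrableZl => //; exact: intg_trunc_pker.
Qed.

Lemma nker_le0 s B t : t <= 0 -> nker s B t = 0.
Proof.
by move=> t0; rewrite /nker /trunc_pker /pker (ltNge 0) t0/=; case: ifP; rewrite mulr0.
Qed.

(** For 0 < r < B the arguments t and r - t, when both positive, are below B, so the cut-offs are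
    invisible and the Beta integral applies. From B on they act: there the left-hand side stands for
    itself and nothing is claimed. *)
Lemma conv_nker_complement alpha B r : 0 < alpha < 1 ->
  conv (nker (1 - alpha) B) (nker alpha B) r =
  if 0 < r then if r < B then 1 else conv (nker (1 - alpha) B) (nker alpha B) r
  else 0.
Proof.
move=> /andP[a0 a1].
case: ifPn => r0; last first.
  transitivity (\int[mu]_t (0 : R)); last by rewrite Rintegral_cst// mul0r.
  apply: eq_Rintegral => t _.
  have [t0|t0] := leP t 0; first by rewrite nker_le0// mul0r.
  by rewrite [X in _ * X]nker_le0 ?mulr0// subr_le0 (le_trans _ (ltW t0))// leNgt.
case: ifPn => // rB.
rewrite /conv /Rintegral.
have G1 := Gamma_gt0 a0 (ltW a1).
have G2 : 0 < Gamma (1 - alpha) by rewrite Gamma_gt0 ?subr_gt0// gerBl ltW.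
have a' : 0 < 1 - alpha < 1 by rewrite subr_gt0 a1 ltrBlDr ltrDl.
rewrite (_ : (\int[mu]_t _)%E = ((Gamma (1 - alpha))^-1 * (Gamma alpha)^-1)%:E *
  \int[mu]_t (pker (1 - alpha) t * pker (1 - (1 - alpha)) (r - t))%:E)%E.
  rewrite beta_complement//= (_ : 1 - (1 - alpha) = alpha)%R; last by ring.
  by field; rewrite !gt_eqF.
rewrite -ge0_integralZl//; first last.
- by rewrite lee_fin mulr_ge0 ?invr_ge0 ?ltW.
- by move=> t _; rewrite lee_fin mulr_ge0 ?pker_ge0.
- apply/measurable_EFinP; apply: measurable_funM; first exact: measurable_pker.
  by apply: measurable_reflect; exact: measurable_pker.
apply: eq_integral => t _; rewrite -EFinM; congr EFin.
rewrite (_ : 1 - (1 - alpha) = alpha)%R; last by ring.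
rewrite /nker /trunc_pker mulrACA; congr (_ * _).
have [t0|t0] := leP t 0; first by rewrite /pker (ltNge 0) t0/= if_same !mul0r.
have [rt|rt] := leP (r - t) 0; first by rewrite /pker (ltNge 0 (r - t)) rt/= if_same !mulr0.
by rewrite ifT ?ifT//; lra.
Qed.

End normalized_kernel.

(** * Smooth bumps and the du Bois-Reymond lemma *)

Section smooth_functions.
Context {R : realType}.
Local Notation mu := (@lebesgue_measure R).
Implicit Types (f g : R -> R) (x c d : R).

(* The derivatives are carried as witnesses, so that the closure lemmas below need no
   rewriting of derive1n. *)
Fixpoint diffn n f : Prop :=
  if n is m.+1 then exists2 g, forall x, is_derive x 1 f (g x) & diffn m g
  else True.

Lemma diffn_derivable n f x : diffn n.+1 f -> derivable (derive1n n f) x 1.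
Proof.
elim: n f => [f [g dg _]|n IH f [g dg ng]]; first by have [] := dg x.
rewrite derive1Sn (_ : derive1 f = g); first exact: IH.
by apply/funext => y; have := dg y => ?; rewrite derive1E derive_val.
Qed.

Lemma derivable_diffn n f : (forall m x, derivable (derive1n m f) x 1) ->
  diffn n f.
Proof.
elim: n f => //= n IH f df; exists (derive1 f).
  by move=> x; rewrite derive1E; apply: DeriveDef => //; exact: (df 0%N).
by apply: IH => m x; rewrite -derive1Sn; exact: df.
Qed.

Lemma diffnW n f : diffn n.+1 f -> diffn n f.
Proof.
by elim: n f => //= n IH f [g dg ng]; exists g => //; exact: IH.
Qed.

Lemma diffn_cst n c : diffn n (fun=> c).
Proof.
by elim: n c => //= n IH c; exists (fun=> 0) => // x; exact: is_derive_cst.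
Qed.

Lemma diffnD n f g : diffn n f -> diffn n g -> diffn n (fun x => f x + g x).
Proof.
elim: n f g => //= n IH f g [f' df nf] [g' dg ng].
exists (fun x => f' x + g' x); last exact: IH.
by move=> x; exact: is_deriveD.
Qed.

Lemma diffnM n f g : diffn n f -> diffn n g -> diffn n (fun x => f x * g x).
Proof.
elim: n f g => // n IH f g nf ng.
case: (nf) (ng) => f' df nf' [g' dg ng'].
exists (fun x => f x * g' x + g x * f' x).
  by move=> x; exact: is_deriveM.
by apply: diffnD; apply: IH => //; exact: diffnW.
Qed.

Lemma diffn_affine n f c d : diffn n f -> diffn n (fun x => f (c * x + d)).
Proof.
elim: n f => //= n IH f [g dg ng].
exists (fun x => g (c * x + d) * c); last first.
  by apply: diffnM; [exact: IH|exact: diffn_cst].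
move=> x.
apply: (@is_derive1_comp _ f (fun x => c * x + d)).
rewrite -[X in is_derive _ _ _ X](_ : c *: 1 + 0 = c); last first.
  by rewrite addr0 /GRing.scale/= mulr1.
by apply: is_deriveD; exact: is_deriveZ.
Qed.

(* The span of this family is stable under derivation, hence made of smooth functions. *)
Definition flat m x : R := if 0 < x then x^-1 ^+ m * expR (- x^-1) else 0.

Lemma flat_ge0 m x : 0 <= flat m x.
Proof.
rewrite /flat; case: ifPn => // x0.
by rewrite mulr_ge0 ?expR_ge0// exprn_ge0// invr_ge0 ltW.
Qed.

(** With y = 1 / x, this bounds [expR y] from below by its Taylor term of degree m + 2. The
    quadratic bound makes the difference quotient at 0 tend to 0 in [is_derive_flat]. *)
Lemma flat_le_sqr m x : flat m x <= (m.+2)`!%:R * x ^+ 2.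
Proof.
rewrite /flat; case: ifPn => [x0|_]; last by rewrite mulr_ge0// sqr_ge0.
set y := x^-1; have y0 : 0 < y by rewrite invr_gt0.
have -> : x = y^-1 by rewrite invrK.
rewrite expRN ler_pdivrMr ?expR_gt0//.
have := @expR_ge1Dxn _ y m.+1 (ltW y0) => le_exp.
have {}le_exp : y ^+ m.+2 / (m.+2)`!%:R <= expR y.
  by apply: le_trans le_exp; rewrite lerDr.
apply: le_trans (_ : (m.+2)`!%:R * y^-1 ^+ 2 * (y ^+ m.+2 / (m.+2)`!%:R) <= _).
  rewrite -[m.+2]addn2 exprD le_eqVlt; apply/orP; left; apply/eqP.
  by field; rewrite pnatr_eq0 -lt0n fact_gt0 gt_eqF.
by rewrite ler_wpM2l// mulr_ge0// sqr_ge0.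
Qed.

Lemma is_derive_flat m x :
  is_derive x 1 (flat m) (- m%:R * flat m.+1 x + flat m.+2 x).
Proof.
have [x0|x0|<-] := ltgtP 0 x.
- have nf : \near x, x^-1 ^+ m * expR (- x^-1) = flat m x.
    near=> y; rewrite /flat ifT//; near: y; exact: lt_nbhsr.
  apply: (near_eq_is_derive nf).
  have dV : is_derive x 1 (fun y : R => y^-1) (- x ^- 2 *: 1).
    by apply: (@is_deriveV _ id); rewrite gt_eqF.
  have dE : is_derive x 1 (fun y : R => expR (- y^-1)) (expR (- x^-1) * - (- x ^- 2 *: 1)).
    apply: (@is_derive1_comp _ expR (fun y => - y^-1)).
  have dX : is_derive x 1 (fun y : R => y^-1 ^+ m) ((m%:R * x^-1 ^+ m.-1) *: (- x ^- 2 *: 1)).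
    by have := is_deriveX m dV; rewrite exprfctE.
  apply: (@is_derive_eq _ _ _ _ _ _ _ _ (is_deriveM dX dE)).
  rewrite /flat x0 /GRing.scale/= !mulr1.
  case: m {dX nf} => [|m] /=; rewrite -!exprVn ?exprS; ring.
- have nf : \near x, 0 = flat m x.
    near=> y; rewrite /flat ifF//; apply/negbTE; rewrite -leNgt ltW//.
    near: y; exact: lt_nbhsl.
  apply: (near_eq_is_derive nf).
  rewrite /flat !ifF ?mulr0 ?addr0; first exact: is_derive_cst.
  + by rewrite ltNge ltW.
  + by rewrite ltNge ltW.
- have fl0 k : flat k 0 = 0 by rewrite /flat ltxx.
  rewrite !fl0 mulr0 addr0.
  have cv : h^-1 *: (flat m (h *: 1 + 0) - flat m 0) @[h --> 0^'] --> (0 : R).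
    apply/cvgrPdist_le => e e0; near=> h.
    have h0 : h != 0 by near: h; exact: nbhs_dnbhs_neq.
    rewrite fl0 subr0 addr0 /GRing.scale/= mulr1 sub0r normrN normrM.
    rewrite normfV ler_pdivrMl ?normr_gt0// ger0_norm ?flat_ge0//.
    apply: (le_trans (flat_le_sqr _ _)).
    rewrite -(real_normK (num_real h)) expr2 mulrCA ler_pM2l ?normr_gt0//.
    rewrite -ler_pdivlMl ?ltr0n ?fact_gt0//.
    near: h; apply: dnbhs0_le.
    by rewrite mulr_gt0 ?invr_gt0 ?ltr0n ?fact_gt0.
  by apply: DeriveDef; [apply/cvg_ex; exists 0|apply/cvg_lim].
Unshelve. all: by end_near. Qed.

Lemma diffn_flat n m : diffn n (flat m).
Proof.
elim: n m => //= n IH m.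
exists (fun x => - m%:R * flat m.+1 x + flat m.+2 x).
  by move=> x; exact: is_derive_flat.
by apply: diffnD => //; apply: diffnM => //; exact: diffn_cst.
Qed.

End smooth_functions.

(** * Bumps, smooth steps and the test functions built from them *)

Section bump.
Context {R : realType}.
Local Notation mu := (@lebesgue_measure R).
Local Notation intg f := (mu.-integrable setT (EFin \o f)).
Implicit Types (f g : R -> R) (x c d e : R).

(** On []0, 1[] this is exp(- 1/x - 1/(1 - x)). It is left unnormalized: its mass stays the
    unevaluated positive constant [bump_mass]. *)
Definition bump x := flat 0 x * flat 0 (1 - x).

Lemma bump_ge0 x : 0 <= bump x.
Proof. by rewrite mulr_ge0 ?flat_ge0. Qed.

Lemma flat0_le1 x : flat 0 x <= 1.
Proof.
rewrite /flat; case: ifPn => // x0.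
by rewrite expr0 mul1r expR_le1 oppr_le0 invr_ge0 ltW.
Qed.

Lemma bump_le1 x : bump x <= 1.
Proof. by rewrite mulr_ile1 ?flat_ge0 ?flat0_le1. Qed.

Lemma bump_out x : ~~ (0 < x < 1) -> bump x = 0.
Proof.
rewrite negb_and -!leNgt => /orP[x0|x1].
  by rewrite /bump /flat ltNge x0/= mul0r.
by rewrite /bump /flat (ltNge 0 (1 - x)) subr_le0 x1/= mulr0.
Qed.

Lemma bump_gt0 x : 0 < x < 1 -> 0 < bump x.
Proof.
move=> /andP[x0 x1]; rewrite /bump /flat x0 subr_gt0 x1 !expr0 !mul1r.
by rewrite mulr_gt0 ?expR_gt0.
Qed.

Lemma diffn_bump n : diffn n bump.
Proof.
apply: diffnM; first exact: diffn_flat.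
have := diffn_affine (-1) 1 (@diffn_flat R n 0).
by congr diffn; apply/funext => x; rewrite mulN1r addrC.
Qed.

Lemma continuous_bump : continuous bump.
Proof.
move=> x; have [g dg _] := diffn_bump 1.
by apply: differentiable_continuous; apply/derivable1_diffP; have [] := dg x.
Qed.

Lemma measurable_bump : measurable_fun setT bump.
Proof. by apply: continuous_measurable_fun => x; exact: continuous_bump. Qed.

Lemma intg_bump : intg bump.
Proof.
apply: (@le_intg _ _ (\1_`[0%R, 1%R])).
- exact: measurable_bump.
- move=> x; rewrite (ger0_norm (bump_ge0 x)) indicE.
  have [|] := boolP (x \in `[0%R, 1%R]%classic).
    by rewrite normr1 bump_le1.
  rewrite notin_setE/= in_itv/= => /negP x01; rewrite bump_out//.
  by apply: contra x01 => /andP[? ?]; rewrite !ltW.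
- exact: integrable_indic_itv.
Qed.

Definition bump_mass := \int[mu]_x bump x.

Lemma bump_mass_gt0 : 0 < bump_mass.
Proof.
rewrite lt_neqAle Rintegral_ge0 ?andbT => [|x _]; last exact: bump_ge0.
apply/negP => /eqP bm0.
have : (\int[mu]_x `|(bump x)%:E| = 0)%E.
  under eq_integral do rewrite gee0_abs ?lee_fin ?bump_ge0//.
  rewrite -[LHS]fineK; first by rewrite -/(Rintegral _ _ _) -/bump_mass -bm0.
  exact: integrable_fin_num intg_bump.
move/(ae_eq_integral_abs mu measurableT) => /(_ _)[].
  by apply/measurable_EFinP; exact: measurable_bump.
move=> N [mN N0 sub].
have : (mu `]0%R, 1%R[%classic <= mu N)%E.
  apply: le_measure; rewrite ?inE//.
  move=> x/=; rewrite in_itv/= => x01; apply: sub => /= /(_ I) [] /eqP.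
  by rewrite gt_eqF// bump_gt0.
by rewrite N0 lebesgue_measure_itv/= lte_fin ltr01 sube0 leNgt lte_fin ltr01.
Qed.

Definition smooth_step x := \int[mu]_(t in `]-oo, x]) bump t.

Lemma is_derive_smooth_step x : is_derive x 1 smooth_step (bump x).
Proof.
have [] := @continuous_FTC1 R bump -oo%O x (x + 1) _ _ _ _.
- by rewrite ltrDl.
- apply: (integrableS measurableT) => //; exact: intg_bump.
- exact: ltNyr.
- exact: continuous_bump.
- by move=> dF dE; apply: DeriveDef => //; rewrite -derive1E.
Qed.

Lemma diffn_smooth_step n : diffn n smooth_step.
Proof.
case: n => // n; exists bump; last exact: diffn_bump.
exact: is_derive_smooth_step.
Qed.

Lemma smooth_step_le0 x : x <= 0 -> smooth_step x = 0.
Proof.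
move=> x0; rewrite /smooth_step.
transitivity (\int[mu]_(t in `]-oo, x]) (0 : R)).
  apply: eq_Rintegral => t; rewrite inE/= in_itv/= => tx; rewrite bump_out//.
  by rewrite ltNge (le_trans tx).
by rewrite Rintegral_cst// mul0r.
Qed.

Lemma smooth_step_ge1 x : 1 <= x -> smooth_step x = bump_mass.
Proof.
move=> x1; rewrite /smooth_step Rintegral_mkcond; apply: eq_Rintegral => t _.
rewrite patchE; case: ifPn => //; rewrite notin_setE/= in_itv/= => /negP.
rewrite -ltNge => xt; rewrite bump_out//.
by rewrite negb_and -!leNgt (le_trans x1 (ltW xt)) orbT.
Qed.

(** Both steps rise to the same height [bump_mass], so they cancel to the right of both bumps; the
    difference, unlike a single step, has compact support. *)
Definition bump_diff c d e x :=
  smooth_step (e^-1 * x + - (c / e)) - smooth_step (e^-1 * x + - (d / e)).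

Lemma is_derive_bump_diff c d e x : is_derive x 1 (bump_diff c d e)
  (e^-1 * bump (e^-1 * x + - (c / e)) - e^-1 * bump (e^-1 * x + - (d / e))).
Proof.
have key c' : is_derive x 1 (fun y => smooth_step (e^-1 * y + - (c' / e)))
    (e^-1 * bump (e^-1 * x + - (c' / e))).
  rewrite [X in is_derive _ _ _ X]mulrC;
  apply: (@is_derive1_comp _ smooth_step (fun y => e^-1 * y + - (c' / e))).
    exact: is_derive_smooth_step.
  rewrite -[X in is_derive _ _ _ X](_ : e^-1 *: 1 + 0 = e^-1); last first.
    by rewrite addr0 /GRing.scale/= mulr1.
  by apply: is_deriveD; exact: is_deriveZ.
exact: is_deriveB.
Qed.

Lemma test_function_bump_diff (a b c d e : R) : 0 < e ->
  a < c -> a < d -> c + e < b -> d + e < b -> test_function a b (bump_diff c d e).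
Proof.
move=> e0 ac ad cb db.
pose m := Num.min c d; pose M := Num.max c d + e.
have am : a < m by rewrite lt_min ac.
have Mb : M < b by rewrite /M -ltrBrDr gt_max !ltrBrDr cb.
have supp : closure [set x | bump_diff c d e x != 0] `<=` `[m, M].
  rewrite [X in _ `<=` X](closure_id _).1; last exact: itv_closed.
  apply: closureS => x /=; rewrite in_itv/=.
  have sub c' : e^-1 * x + - (c' / e) = (x - c') / e by rewrite mulrBl mulrC.
  apply: contraNT; rewrite negb_and -!ltNge /bump_diff !sub => /orP[xm|Mx].
    rewrite !smooth_step_le0 ?subrr//.
      by rewrite pmulr_lle0 ?invr_gt0// subr_le0 (le_trans (ltW xm))// ge_min lexx orbT.
    by rewrite pmulr_lle0 ?invr_gt0// subr_le0 (le_trans (ltW xm))// ge_min lexx.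
  rewrite !smooth_step_ge1 ?subrr//.
    rewrite ler_pdivlMr// mul1r lerBrDr addrC (le_trans _ (ltW Mx))//.
    by rewrite lerD2r le_max lexx orbT.
  rewrite ler_pdivlMr// mul1r lerBrDr addrC (le_trans _ (ltW Mx))//.
  by rewrite lerD2r le_max lexx.
split.
- move=> n x; apply: diffn_derivable; rewrite /bump_diff.
  apply: diffnD; first by apply: diffn_affine; exact: diffn_smooth_step.
  have := diffnM (diffn_cst n.+1 (-1))
    (diffn_affine e^-1 (- (d / e)) (diffn_smooth_step n.+1)).
  by congr diffn; apply/funext => y; rewrite mulN1r.
- apply: subclosed_compact supp; first exact: closed_closure.
  exact: segment_compact.
- move=> x /supp; rewrite /= !in_itv/= => /andP[mx xM].
  by rewrite (lt_le_trans am mx) (le_lt_trans xM Mb).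
Qed.

End bump.

(** * The du Bois-Reymond lemma *)

Section du_bois_reymond.
Context {R : realType}.
Local Notation mu := (@lebesgue_measure R).
Local Notation intg f := (mu.-integrable setT (EFin \o f)).
Implicit Types (f g W : R -> R) (x c d e : R).

Lemma intg_bump_affine c e : 0 < e ->
  intg (fun y => e^-1 * bump (e^-1 * y + - (c / e))).
Proof.
move=> e0.
have mb : measurable_fun setT (fun y => bump (e^-1 * y + - (c / e))).
  by apply: (measurableT_comp measurable_bump); exact: measurable_affine.
apply: intgP; first exact: measurable_funM.
under eq_integral do rewrite normrM EFinM.
rewrite ge0_integralZl//; last by apply/measurable_EFinP; exact: measurableT_comp.
rewrite ger0_norm ?invr_ge0 ?ltW//.
rewrite (@ge0_integral_affine _ e^-1 (- (c / e)) (fun y => `|bump y|%:E)) ?invr_gt0//.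
  by apply: intg_lty; exact: intg_bump.
by apply/measurable_EFinP; apply: measurableT_comp => //; exact: measurable_bump.
Qed.

Lemma Rintegral_bump_affine c e : 0 < e ->
  \int[mu]_y (e^-1 * bump (e^-1 * y + - (c / e))) = bump_mass.
Proof.
move=> e0; rewrite /bump_mass /Rintegral.
rewrite -[in RHS](@ge0_integral_affine _ e^-1 (- (c / e)) (fun y => (bump y)%:E)) ?invr_gt0//.
- rewrite -ge0_integralZl//.
  + by apply/measurable_EFinP; apply: (measurableT_comp measurable_bump);
      exact: measurable_affine.
  + by move=> y _; rewrite lee_fin bump_ge0.
  + by rewrite lee_fin invr_ge0 ltW.
- by apply/measurable_EFinP; exact: measurable_bump.
- by move=> y; rewrite lee_fin bump_ge0.
Qed.

(* The factor 2 comes from |ball c e| = 2 e in the average davg. *)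
Lemma bump_approximation W c e : intg W -> 0 < e ->
  (`|\int[mu]_y (W y * (e^-1 * bump (e^-1 * y + - (c / e)))) - W c * bump_mass|%:E
   <= 2%:E * davg W c e)%E.
Proof.
move=> intW e0; set b := fun y : R => e^-1 * bump (e^-1 * y + - (c / e)).
have ib : intg b by exact: intg_bump_affine.
have b_le y : `|b y| <= e^-1.
  have e'0 : 0 <= e^-1 by rewrite invr_ge0 ltW.
  rewrite ger0_norm; last by rewrite mulr_ge0// bump_ge0.
  by rewrite ler_piMr// bump_le1.
have iWb : intg (fun y => W y * b y).
  under [X in _.-integrable _ X]eq_fun do rewrite /= mulrC.
  by apply: intgM_bounded b_le intW; exact: intg_measurable.
have icb : intg (fun y => W c * b y) by exact: intgZ.
rewrite -(Rintegral_bump_affine c e0) -RintegralZl// -RintegralB//.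
rewrite EFin_normr_Rintegral//; last exact: intgB.
have mD : measurable_fun setT (fun y => W y - W c).
  by apply: measurable_funB => //; exact: intg_measurable.
have mWb : measurable_fun setT (fun y => W y * b y - W c * b y).
  by apply: measurable_funB; exact: intg_measurable.
have mWb' : measurable_fun setT (fun y => (W y * b y - W c * b y)%:E).
  exact/measurable_EFinP.
apply: (le_trans (le_abse_integral mu measurableT mWb')).
rewrite /davg /iavg (lebesgue_measure_ball c (ltW e0)) inver gt_eqF ?mulrn_wgt0//.
rewrite muleA -EFinM (_ : 2 * (e *+ 2)^-1 = e^-1); last first.
  by rewrite mulr2n; field; rewrite gt_eqF.
rewrite -ge0_integralZl//; last 3 first.
- exact: measurable_ball.
- by apply/measurable_EFinP; apply: measurableT_comp => //; exact: measurable_funTS.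
- by rewrite lee_fin invr_ge0 ltW.
rewrite [leRHS]integral_mkcond; apply: ge0_le_integral => //.
- exact: (measurableT_comp _ mWb').
- apply/(measurable_restrictT _ _).1; first exact: measurable_ball.
  apply/measurable_EFinP; apply: measurable_funM => //; apply: measurableT_comp => //.
  exact: measurable_funTS.
- move=> y _; rewrite patchE /= -mulrBl normrM; case: ifPn => yc.
    by rewrite -EFinM lee_fin mulrC ler_wpM2r.
  (* The rescaled bump lives on []c, c + e[], the right half of the ball. *)
  rewrite /b bump_out ?mulr0 ?normr0 ?mulr0//.
  apply: contra yc => /andP[y0 y1]; rewrite inE/= ball_itv/= in_itv/=.
  move: y0 y1; rewrite (_ : e^-1 * y + - (c / e) = (y - c) / e); last first.
    by rewrite mulrBl mulrC.
  rewrite pmulr_lgt0 ?invr_gt0// ltr_pdivrMr// mul1r => ? ?.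
  by apply/andP; split; lra.
Qed.

Lemma ae_exists_itv (P : R -> Prop) (a b : R) : a < b -> {ae mu, forall x, P x} ->
  exists2 x, a < x < b & P x.
Proof.
move=> ab [N [mN N0 sub]]; apply: contrapT => nP.
have : (mu `]a, b[%classic <= mu N)%E.
  apply: le_measure; rewrite ?inE//.
  move=> x/=; rewrite in_itv/= => xab; apply: sub => /= Px.
  by apply: nP; exists x.
by rewrite N0 lebesgue_measure_itv/= lte_fin ab -EFinD leNgt lte_fin subr_gt0 ab.
Qed.

Lemma ae_cst_of_test W (a b : R) : a < b -> intg W ->
  (forall phi, test_function a b phi -> \int[mu]_x (W x * derive1 phi x) = 0) ->
  exists C, {ae mu, forall x, a < x < b -> W x = C}.
Proof.
move=> ab intW Wtest.
have locW : locally_integrable setT W.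
  by apply: open_integrable_locally => //; exact: openT.
have lebW := lebesgue_differentiation locW.
(* One Lebesgue point c is fixed and supplies the constant; every other Lebesgue point d of the
   interval is then compared with it. *)
have [c /andP[ac cb] Lc] := ae_exists_itv ab lebW.
exists (W c); apply: ae_imply lebW => d Ld /andP[ad db].
have B0 := @bump_mass_gt0 R.
suff : (`|W d * bump_mass - W c * bump_mass|%:E <= 0)%E.
  rewrite lee_fin normr_le0 -mulrBl mulf_eq0 (gt_eqF B0) orbF subr_eq0.
  by move/eqP.
have cv1 x : lebesgue_pt W x -> (2%:E * davg W x e @[e --> 0^'+] --> 0)%E.
  move=> Lx; rewrite -[X in _ --> X](_ : 2%:E * 0 = 0)%E; last by rewrite mule0.
  exact: cvgeZl.
have cv : (2%:E * davg W c e + 2%:E * davg W d e @[e --> 0^'+] --> 0)%E.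
  rewrite -[X in _ --> X](_ : 0 + 0 = 0)%E; last by rewrite adde0.
  by apply: cvgeD => //; exact: cv1.
(* The quantity to be bounded does not depend on e; it is bounded for each e small enough that both
   bumps end before b. *)
apply: cvge_ge cv; near=> e.
have e0 : 0 < e by [].
have ce : c + e < b.
  by rewrite addrC -ltrBrDr; near: e; apply: (@nbhs_right_lt R 0 (b - c)); rewrite subr_gt0.
have de : d + e < b.
  by rewrite addrC -ltrBrDr; near: e; apply: (@nbhs_right_lt R 0 (b - d)); rewrite subr_gt0.
have := Wtest _ (test_function_bump_diff e0 ac ad ce de).
pose bb c' y : R := W y * (e^-1 * bump (e^-1 * y + - (c' / e))).
have ibb c' : intg (bb c').
  rewrite /bb; under [X in _.-integrable _ X]eq_fun do rewrite /= mulrC.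
  apply: (@intgM_bounded _ _ _ e^-1) intW.
    exact: intg_measurable (intg_bump_affine c' e0).
  move=> y; have e'0 : 0 <= e^-1 by rewrite invr_ge0 ltW.
  rewrite ger0_norm; last by rewrite mulr_ge0// bump_ge0.
  by rewrite ler_piMr// bump_le1.
have -> : \int[mu]_x (W x * derive1 (bump_diff c d e) x) =
    \int[mu]_x bb c x - \int[mu]_x bb d x.
  rewrite -RintegralB//; apply: eq_Rintegral => x _.
  have := is_derive_bump_diff c d e x => dbd.
  by rewrite derive1E derive_val mulrBr.
move/eqP; rewrite subr_eq0 => /eqP bcd.
have hc : (`|\int[mu]_x bb c x - W c * bump_mass|%:E <= 2%:E * davg W c e)%E.
  exact: bump_approximation.
have hd : (`|\int[mu]_x bb d x - W d * bump_mass|%:E <= 2%:E * davg W d e)%E.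
  exact: bump_approximation.
apply: le_trans (leeD hc hd); rewrite bcd -EFinD lee_fin.
set J := \int[mu]_x bb d x.
rewrite [leRHS]addrC (distrC J (W d * _)) (le_trans _ (ler_normD _ _))//.
by rewrite subrKA.
Unshelve. all: by end_near. Qed.
End du_bois_reymond.

(** * Test functions and fractional operators *)

Section test_functions.
Context {R : realType}.
Local Notation mu := (@lebesgue_measure R).
Local Notation intg f := (mu.-integrable setT (EFin \o f)).
Implicit Types (f g phi : R -> R) (a b x s alpha : R).

Lemma test_function_out a b phi x : test_function a b phi -> ~~ (a < x < b) ->
  phi x = 0 /\ derive1 phi x = 0.
Proof.
move=> [dphi _ supp] xab.
have nx : ~ closure [set x | phi x != 0] x.
  by move/supp; rewrite /= in_itv/=; apply/negP.
have : \forall y \near x, ~ closure [set x | phi x != 0] y.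
  apply: (@open_nbhs_nbhs _ x (~` closure [set x | phi x != 0])); split => //.
  by apply: closed_openC; exact: closed_closure.
have out y : ~ closure [set x | phi x != 0] y -> phi y = 0.
  by move=> ny; apply: contrapT => /eqP y0; apply: ny; exact: subset_closure.
move=> nearx; split; first exact: out.
have : \forall y \near x, (cst 0 : R -> R) y = phi y.
  by apply: filterS nearx => y /out ->.
move/near_eq_derive => /(_ 1); rewrite derive1E => <-.
exact: derive_cst.
Qed.

Lemma derive1_test_continuous a b phi : test_function a b phi ->
  continuous phi /\ continuous (derive1 phi).
Proof.
move=> [dphi _ _]; split => x; apply: differentiable_continuous;
  apply/derivable1_diffP.
- exact: (dphi 0%N).
- exact: (dphi 1%N).
Qed.

Lemma test_function_derivable a b phi x : test_function a b phi -> derivable phi x 1.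
Proof. by move=> [dphi _ _]; exact: (dphi 0%N). Qed.

Lemma continuous_vanish_bounded a b g : a < b -> continuous g ->
  (forall x, ~~ (a < x < b) -> g x = 0) -> exists M : R, forall x, `|g x| <= M.
Proof.
move=> ab cg g0.
have cn : {within `[a, b], continuous (fun x => `|g x|)}.
  apply: continuous_subspaceT => x.
  by apply: continuous_comp; [exact: cg|exact: norm_continuous].
have [c _ cM] := EVT_max (ltW ab) cn.
exists `|g c| => x; have [xab|/g0 ->] := boolP (a < x < b); last by rewrite normr0.
by apply: cM; rewrite in_itv/=; move/andP : xab => [? ?]; rewrite !ltW.
Qed.

Lemma test_function_bounded a b phi : a < b -> test_function a b phi ->
  exists M : R, forall x, `|phi x| <= M /\ `|derive1 phi x| <= M.
Proof.
move=> ab tphi; have [c0 c1] := derive1_test_continuous tphi.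
have [M0 hM0] := continuous_vanish_bounded ab c0
  (fun x xab => (test_function_out tphi xab).1).
have [M1 hM1] := continuous_vanish_bounded ab c1
  (fun x xab => (test_function_out tphi xab).2).
exists (Num.max M0 M1) => x.
by rewrite !le_max hM0 hM1 orbT.
Qed.

Lemma test_function_measurable a b phi : test_function a b phi ->
  measurable_fun setT phi /\ measurable_fun setT (derive1 phi).
Proof.
move=> tphi; have [c0 c1] := derive1_test_continuous tphi.
by split; apply: continuous_measurable_fun => x; [exact: c0|exact: c1].
Qed.

(** The kernel is merely integrable, so the shift y = s + x first moves the variable x onto phi.
    Then M |k s| dominates the derivative of the integrand in x. *)
Lemma is_derive_conv_reflect a b phi (k : R -> R) x : a < b -> test_function a b phi ->
  intg k ->
  is_derive x 1 (fun x => \int[mu]_y (phi y * k (y - x)))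
    (\int[mu]_y (derive1 phi y * k (y - x))).
Proof.
move=> ab tphi ik.
have [M hM] := test_function_bounded ab tphi.
have [m0 m1] := test_function_measurable tphi.
have mk := intg_measurable ik.
have eq1 (psi : R -> R) : measurable_fun setT psi -> forall z,
    \int[mu]_y (psi y * k (y - z)) = \int[mu]_s (psi (s + z) * k s).
  move=> mpsi z; rewrite -[LHS](Rintegral_shift z); last first.
    by apply: measurable_funM => //; exact: (measurable_shift (- z)).
  by apply: eq_Rintegral => s _; rewrite addrK.
rewrite (eq1 _ m1) (_ : (fun x => _) = fun z => \int[mu]_s (phi (s + z) * k s)); last first.
  by apply/funext => z; exact: eq1.
pose f z s := phi (s + z) * k s.
have df (z s : R) : is_derive z 1 (f ^~ s) (derive1 phi (s + z) * k s).
  have d1 : is_derive z 1 (fun z : R => phi (s + z)) (derive1 phi (s + z) * 1).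
    apply: (@is_derive1_comp _ phi (fun z => s + z)).
      rewrite derive1E; apply: DeriveDef => //; exact: test_function_derivable tphi.
    rewrite -[X in is_derive _ _ _ X](add0r 1).
    exact: is_deriveD.
  have := is_deriveM d1 (is_derive_cst (k s) z 1).
  rewrite scaler0 add0r mulr1 => H.
  by rewrite mulrC.
have fI (z : R) : z \in `](x - 1), (x + 1)[%classic -> intg (f z).
  move=> _; apply: (@intgM_bounded _ _ (fun s => phi (s + z)) M) => //.
    exact: measurable_shift.
  by move=> s; have [] := hM (s + z).
have fd (z s : R) : (`](x - 1), (x + 1)[%classic : set R) z -> [set: R] s ->
    derivable (f ^~ s) z 1.
  by move=> _ _; have [] := df z s.
have iG : intg (fun s => `|M * k s|).
  by apply: integrable_norm; exact: intgZ.
have fG (z s : R) : (`](x - 1), (x + 1)[%classic : set R) z -> [set: R] s ->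
    `|partial1of2 f z s| <= `|M * k s|.
  move=> _ _; have := df z s => dfz.
  rewrite partial1of2E derive_val !normrM ler_wpM2r//.
  by have [_ h] := hM (s + z); rewrite (le_trans h)// ler_norm.
have Ix : (`](x - 1), (x + 1)[%classic : set R) x.
  by rewrite /= in_itv/= gtrBl ltrDl ltr01.
have G0 (s : R) : 0 <= `|M * k s| by [].
have fI' (z : R) : (`](x - 1), (x + 1)[%classic : set R) z -> intg (f z).
  by move=> ?; apply: fI; rewrite inE.
have dF := derivable_under_integral measurableT Ix fI' fd G0 iG fG.
have := differentiation_under_integral measurableT Ix fI' fd G0 iG fG.
rewrite derive1E => F'.
apply: DeriveDef => //; rewrite F'.
apply: eq_Rintegral => s _; have := df x s => dfx.
by rewrite partial1of2E derive_val.
Qed.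

Lemma frac_int_rightE a b s f x : measurable_fun setT (f \_ `]a, b[) -> a < x < b ->
  frac_int_right b s f x = \int[mu]_y ((f \_ `]a, b[) y * nker s (b - a) (y - x)).
Proof.
move=> mf /andP[ax xb].
have -> : (fun y => (f \_ `]a, b[) y * nker s (b - a) (y - x)) =
    (fun y => (Gamma s)^-1 * ((f \_ `]a, b[) y * trunc_pker s (b - a) (y - x))).
  by apply/funext => y; rewrite /nker mulrCA.
rewrite RintegralZlT; last first.
  apply: measurable_funM => //; apply: (measurable_shift (- x)).
  exact: measurable_trunc_pker.
congr (_ * _); rewrite Rintegral_mkcond; apply: eq_Rintegral => y _.
rewrite !patchE; case: ifPn; rewrite ?inE ?notin_setE/= in_itv/=.
  move=> /andP[xy yb]; rewrite ifT; last by rewrite inE/= in_itv/= yb (lt_trans ax).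
  rewrite /trunc_pker /pker subr_gt0 xy ifT; last by lra.
  by rewrite -powRN; congr (_ * _ `^ _); ring.
move=> /negP; rewrite negb_and -!leNgt => /orP[yx|yb].
  by rewrite /trunc_pker /pker subr_gt0 (ltNge x) yx/= if_same mulr0.
rewrite ifF ?mul0r//; apply/negbTE; rewrite notin_setE/= in_itv/=; apply/negP.
by rewrite negb_and -!leNgt yb orbT.
Qed.

Lemma restrict_test_function a b phi : test_function a b phi ->
  phi \_ `]a, b[ = phi.
Proof.
move=> tphi; apply/funext => y; rewrite patchE; case: ifPn => //.
rewrite notin_setE/= in_itv/= => /negP yab.
by have [] := test_function_out tphi yab.
Qed.

Lemma frac_int_leftE a b s f x : measurable_fun setT (f \_ `]a, b[) -> a < x < b ->
  frac_int_left a s f x = conv (f \_ `]a, b[) (nker s (b - a)) x.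
Proof.
move=> mf /andP[ax xb]; rewrite /conv.
have -> : (fun y => (f \_ `]a, b[) y * nker s (b - a) (x - y)) =
    (fun y => (Gamma s)^-1 * ((f \_ `]a, b[) y * trunc_pker s (b - a) (x - y))).
  by apply/funext => y; rewrite /nker mulrCA.
rewrite RintegralZlT; last first.
  apply: measurable_funM => //; apply: measurable_reflect.
  exact: measurable_trunc_pker.
congr (_ * _); rewrite Rintegral_mkcond; apply: eq_Rintegral => y _.
rewrite !patchE; case: ifPn; rewrite ?inE ?notin_setE/= in_itv/=.
  move=> /andP[ay yx]; rewrite ifT; last by rewrite inE/= in_itv/= ay (lt_trans yx).
  rewrite /trunc_pker /pker subr_gt0 yx ifT; last by lra.
  by rewrite -powRN; congr (_ * _ `^ _); ring.
move=> /negP; rewrite negb_and -!leNgt => /orP[ya|xy].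
  rewrite ifF ?mul0r//; apply/negbTE; rewrite notin_setE/= in_itv/=; apply/negP.
  by rewrite negb_and -leNgt ya.
by rewrite /trunc_pker /pker subr_gt0 (ltNge y) xy/= if_same mulr0.
Qed.

(** The derivative passes onto phi without a boundary term at b, since phi is smooth on the whole
    line and vanishes from b on. The convolution formula for the fractional integral holds on []a,
    b[], hence near x, which is enough to differentiate it. *)
Lemma frac_der_right_test a b alpha phi x : a < x < b -> alpha < 1 ->
  test_function a b phi ->
  frac_der_right b alpha phi x =
  - \int[mu]_y (derive1 phi y * nker (1 - alpha) (b - a) (y - x)).
Proof.
move=> axb a1 tphi; have ab : a < b by case/andP: axb => /lt_trans; apply.
have [m0 m1] := test_function_measurable tphi.
have ik : intg (nker (1 - alpha) (b - a)) by apply: intg_nker; rewrite subr_gt0.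
have d := is_derive_conv_reflect x ab tphi ik.
have ne : \forall z \near x, \int[mu]_y (phi y * nker (1 - alpha) (b - a) (y - z)) =
    frac_int_right b (1 - alpha) phi z.
  have : \forall z \near x, z \in `]a, b[ by apply: near_in_itvoo; rewrite in_itv.
  apply: filterS => z; rewrite in_itv/= => azb.
  by rewrite (frac_int_rightE _ _ azb) restrict_test_function.
have d' := near_eq_is_derive ne d.
by rewrite /frac_der_right derive1E derive_val.
Qed.

(** The window of length b - a starting at x ends beyond b, where phi vanishes. This is the order 1
    counterpart of [frac_der_right_test]; it gives the pairing of v with phi a form to which
    [conv_dual] applies. *)
Lemma test_functionE a b phi x : a < x < b -> test_function a b phi ->
  \int[mu]_y (derive1 phi y * \1_`]0, (b - a)[ (y - x)) = - phi x.
Proof.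
move=> /andP[ax xb] tphi; have ab := lt_trans ax xb.
have [c0 c1] := derive1_test_continuous tphi.
have xB : x < x + (b - a) by rewrite ltrDl subr_gt0.
have ftc : (\int[mu]_(t in `[x, (x + (b - a))%R]) (derive1 phi t)%:E =
    (phi (x + (b - a))%R)%:E - (phi x)%:E)%E.
  apply: continuous_FTC2 => //.
  - exact: continuous_subspaceT.
  - split.
    + by move=> z _; exact: test_function_derivable tphi.
    + by apply: cvg_at_right_filter; exact: c0.
    + by apply: cvg_at_left_filter; exact: c0.
have phi0 : phi (x + (b - a)) = 0.
  have [] := @test_function_out _ _ _ (x + (b - a)) tphi => //.
  by rewrite negb_and -!leNgt; apply/orP; right; lra.
rewrite phi0 sub0e in ftc.
have -> : \int[mu]_y (derive1 phi y * \1_`]0, (b - a)[ (y - x)) =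
    \int[mu]_(t in `]x, (x + (b - a))[) derive1 phi t.
  rewrite [RHS]Rintegral_mkcond; apply: eq_Rintegral => t _; rewrite patchE indicE.
  rewrite (_ : (t - x \in `]0, (b - a)[%classic) = (t \in `]x, (x + (b - a))[%classic)).
    by case: ifP => _; rewrite ?mulr1 ?mulr0.
  by apply/idP/idP; rewrite !inE/= !in_itv/= subr_gt0 ltrBlDl.
have mphi : measurable_fun setT (EFin \o derive1 phi).
  by apply/measurable_EFinP; have [] := test_function_measurable tphi.
rewrite /Rintegral integral_itv_bndo_bndc; last exact: measurable_funTS.
rewrite integral_itv_obnd_cbnd; last exact: measurable_funTS.
by rewrite ftc.
Qed.

End test_functions.

(** * Primitives and inversion *)

Section primitive.
Context {R : realType}.
Local Notation mu := (@lebesgue_measure R).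
Local Notation intg f := (mu.-integrable setT (EFin \o f)).
Implicit Types (f g : R -> R) (a b x e : R).

(** For the functions in question, which vanish to the left of a, this is the integral from a. *)
Definition primitive f x := \int[mu]_(t in `]-oo, x]) f t.

Lemma primitiveB f x y : intg f -> x <= y ->
  primitive f y - primitive f x = \int[mu]_(t in `]x, y]) f t.
Proof.
move=> intf xy; rewrite /primitive Rintegral_itvB//.
exact: integrableS intf.
Qed.

(** At each point the excess over n is eventually 0, and |f| dominates it. This splits |f| into a
    bounded part and a part of small integral, the source of absolute continuity of the
    primitive. *)
Lemma integral_excess_small f e : intg f -> 0 < e ->
  exists n : nat, \int[mu]_x (`|f x| - Num.min `|f x| n%:R) < e.
Proof.
move=> intf e0; have mf := intg_measurable intf.
pose h (n : nat) x : R := `|f x| - Num.min `|f x| n%:R.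
have maf : measurable_fun setT (fun x => `|f x|) by exact: measurableT_comp.
have mh n : measurable_fun setT (h n).
  by apply: measurable_funB => //; apply: measurable_minr.
have h0 n x : 0 <= h n x by rewrite subr_ge0 ge_min lexx.
have hle n x : h n x <= `|f x| by rewrite gerBl le_min normr_ge0 ler0n.
have ih n : intg (h n).
  by apply: le_intg intf => // x; rewrite ger0_norm.
have hcvg x : (h n x)%:E @[n --> \oo] --> (0%E : \bar R).
  apply: cvg_near_cst; near=> n; rewrite /h.
  have fn : `|f x| <= n%:R by near: n; exact: nbhs_infty_ger.
  by rewrite (min_idPl fn) subrr.
have mhE n : measurable_fun setT (fun x => (h n x)%:E).
  by apply/measurable_EFinP; exact: mh.
have iaf : mu.-integrable setT (fun x => `|f x|%:E) by exact: integrable_norm.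
have dom : {ae mu, forall x (n : nat), setT x -> (`|(h n x)%:E| <= `|f x|%:E)%E}.
  by apply/aeW => x n _; rewrite /= lee_fin ger0_norm.
have lim0 : {ae mu, forall x, setT x ->
    (h n x)%:E @[n --> \oo] --> (cst 0%E : R -> \bar R) x}.
  by apply/aeW => x _; exact: hcvg.
have [_ _] :=
  @dominated_convergence _ (measurableTypeR R) R mu setT measurableT _ _ _ mhE
    (measurable_cst 0%E) lim0 iaf dom.
rewrite integral0 => /fine_cvgP[_] /cvgrPdist_lt/(_ _ e0)[n _ /(_ n (leqnn n))].
rewrite /= sub0r normrN => hn; exists n; apply: le_lt_trans hn.
exact: ler_norm.
Unshelve. all: by end_near. Qed.

Lemma sum_Rintegral_disjoint_le f n (l r : 'I_n -> R) : intg f ->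
  (forall x, 0 <= f x) -> trivIset setT (fun i => `]l i, r i[%classic) ->
  \sum_(i < n) \int[mu]_(t in `]l i, r i[) f t <= \int[mu]_x f x.
Proof.
move=> intf f0 tF.
have ifin i : (\int[mu]_(t in `]l i, r i[) (f t)%:E \is a fin_num)%E.
  by apply: integrable_fin_num => //; exact: integrableS intf.
have iT : (\int[mu]_t (f t)%:E \is a fin_num)%E by exact: integrable_fin_num.
rewrite -lee_fin -sumEFin /Rintegral.
under eq_bigr do rewrite fineK//.
rewrite fineK//.
have mf : measurable_fun setT (EFin \o f).
  by apply/measurable_EFinP; exact: intg_measurable.
rewrite -(@ge0_integral_bigsetU _ _ _ mu _ (fun i => `]l i, r i[%classic) (EFin \o f)) //=.
- apply: ge0_subset_integral => //.
    by apply: bigsetU_measurable => i _; exact: measurable_itv.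
  by move=> x _; rewrite lee_fin.
- exact: index_enum_uniq.
- exact: sub_trivIset tF.
- exact: measurable_funTS.
- by move=> x _; rewrite lee_fin.
Qed.

Lemma primitive_absolutely_continuous f a b c : intg f ->
  absolutely_continuous a b (fun x => c + primitive f x).
Proof.
move=> intf e e0; have e20 : 0 < e / 2 by rewrite divr_gt0.
have [n hn] := integral_excess_small intf e20.
pose h x : R := `|f x| - Num.min `|f x| n%:R.
have iaf : intg (fun x => `|f x|) by exact: integrable_norm.
have h0 x : 0 <= h x by rewrite subr_ge0 ge_min lexx.
have ih : intg h.
  apply: (le_intg _ _ iaf).
    apply: measurable_funB; first exact: intg_measurable iaf.
    by apply: measurable_minr => //; exact: intg_measurable iaf.
  by move=> x; rewrite ger0_norm// normr_id gerBl le_min normr_ge0 ler0n.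
have M0 : 0 < n.+1%:R :> R by [].
(* The bounded part of |f| contributes at most n + 1 times the total length, hence less than e / 2,
   and the excess over n at most e / 2. Taking [n.+1] keeps the divisor positive when n = 0. *)
exists (e / 2 / n.+1%:R); first by rewrite divr_gt0.
move=> m l r lr tF sd.
have one i : `|c + primitive f (r i) - (c + primitive f (l i))| <=
    n.+1%:R * (r i - l i) + \int[mu]_(t in `]l i, r i[) h t.
  have [_ lri _] := lr i.
  have isub (g : R -> R) (A : set R) : measurable A -> intg g ->
      mu.-integrable A (EFin \o g).
    by move=> mA; exact: integrableS.
  rewrite opprD addrACA subrr add0r (primitiveB intf (ltW lri)).
  rewrite -Rintegral_itv_bndo_bndc; last exact: isub.
  apply: (le_trans (le_normr_Rintegral _ (isub f _ _ intf))) => //.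
  have ic : mu.-integrable `]l i, r i[ (EFin \o (fun=> n.+1%:R : R)).
    apply: measurable_bounded_integrable => //; last exact: bounded_cst.
    by rewrite /= lebesgue_measure_itv/=; case: ifP => _; rewrite ?ltry.
  apply: (@le_trans _ _ (\int[mu]_(t in `]l i, r i[) (n.+1%:R + h t))).
    apply: le_Rintegral => //; first exact: isub.
      exact: (integrableD _ ic (isub _ _ _ ih)).
    move=> t _; rewrite /h addrCA lerDl subr_ge0 ge_min.
    by rewrite ler_nat leqnSn orbT.
  rewrite RintegralD//; last exact: isub.
  rewrite Rintegral_cst//= lebesgue_measure_itv/= lte_fin lri/=.
  by rewrite lexx.
apply: (le_lt_trans (ler_sum _ (fun i _ => one i))).
rewrite big_split/= -mulr_sumr (splitr e) ltr_leD//.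
  by rewrite mulrC -ltr_pdivlMr.
apply: (le_trans _ (ltW hn)).
exact: sum_Rintegral_disjoint_le.
Qed.

(** At a Lebesgue point x the primitive has derivative f x. It vanishes at x and, being 0 almost
    everywhere, at points y > x arbitrarily close to x; the difference quotient is 0 there, which
    excludes a nonzero f x. *)
Lemma primitive_ae0 f a b : intg f -> a < b ->
  {ae mu, forall x, a < x < b -> primitive f x = 0} ->
  {ae mu, forall x, a < x < b -> f x = 0}.
Proof.
move=> intf ab P0.
have locf : locally_integrable setT f.
  by apply: open_integrable_locally => //; exact: openT.
apply: (ae_imply2 _ P0 (lebesgue_differentiation locf)) => x Px' Lx axb.
have Px := Px' axb; apply: contrapT => /eqP fx0.
have [_ xb] := andP axb; have [ax _] := andP axb.
have [] := @FTC1_lebesgue_pt _ f -oo%O x (x + 1) _ _ _ Lx.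
- by rewrite ltrDl.
- by apply: integrableS intf.
- exact: ltNyr.
rewrite -/(primitive f) => dP; rewrite derive1E => DP.
have : is_derive x 1 (primitive f) (f x) by apply: DeriveDef.
move=> _.
have /cvg_ex[L /= cL] := dP.
have LE : L = f x.
  by rewrite -DP; apply/esym/cvg_lim.
rewrite {}LE in cL.
have /cvgrPdist_lt/(_ `|f x|) := cL.
rewrite normr_gt0 => /(_ fx0)/nbhs_ballP[r /= r0 hr].
have xm : x < Num.min b (x + r) by rewrite lt_min xb ltrDl.
have [y /andP[xy + ] Py] := ae_exists_itv xm P0; rewrite lt_min => /andP[yb yr].
have /= := hr (y - x); rewrite /ball/= sub0r normrN.
rewrite gtr0_norm ?subr_gt0// ltrBlDr addrC => /(_ yr).
rewrite subr_eq0 gt_eqF// => /(_ isT).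
rewrite /GRing.scale/= mulr1 subrK Px Py ?subrr ?mulr0 ?subr0 ?ltxx//.
by rewrite (lt_trans ax xy).
Qed.

End primitive.

(** * Weak primitives and Abel inversion on the left *)

Section left_case.
Context {R : realType}.
Local Notation mu := (@lebesgue_measure R).
Local Notation intg f := (mu.-integrable setT (EFin \o f)).
Implicit Types (f g k U V : R -> R) (a b x alpha : R).

Lemma ae_convD f g k : intg f -> intg g -> intg k ->
  {ae mu, forall x, conv (fun y => f y + g y) k x = conv f k x + conv g k x}.
Proof.
move=> fi gi ki.
have a1 := ae_integrable1 (integrable_conv_integrand fi ki).
have a2 := ae_integrable1 (integrable_conv_integrand gi ki).
apply: (ae_imply2 _ a1 a2) => x i1 i2.
rewrite /conv -(RintegralD measurableT i1 i2); apply: eq_Rintegral => y _; exact: mulrDl.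
Qed.

Lemma ae_convB f g k : intg f -> intg g -> intg k ->
  {ae mu, forall x, conv (fun y => f y - g y) k x = conv f k x - conv g k x}.
Proof.
move=> fi gi ki.
have a1 := ae_integrable1 (integrable_conv_integrand fi ki).
have a2 := ae_integrable1 (integrable_conv_integrand gi ki).
apply: (ae_imply2 _ a1 a2) => x i1 i2.
rewrite /conv -(RintegralB measurableT i1 i2); apply: eq_Rintegral => y _; exact: mulrBl.
Qed.

(** For a one-sided kernel the first alternative covers all y >= x, so agreement is required only to
    the left of x. *)
Lemma eq_conv_left f g k x : measurable_fun setT f -> measurable_fun setT g ->
  measurable_fun setT k -> {ae mu, forall y, k (x - y) = 0 \/ f y = g y} ->
  conv f k x = conv g k x.
Proof.
move=> mf mg mk fg; apply: ae_eq_Rintegral.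
- by apply: measurable_funM => //; exact: measurable_reflect.
- by apply: measurable_funM => //; exact: measurable_reflect.
- by apply: ae_imply fg => y [->|->]; rewrite ?mulr0.
Qed.

Lemma conv_left0 f k a x : (forall y, y <= a -> f y = 0) ->
  (forall t, t <= 0 -> k t = 0) -> x <= a -> conv f k x = 0.
Proof.
move=> f0 k0 xa; transitivity (\int[mu]_y (0 : R)); last by rewrite Rintegral_cst// mul0r.
apply: eq_Rintegral => y _; have [ya|ay] := leP y a; first by rewrite f0// mul0r.
by rewrite k0 ?mulr0// subr_le0 (le_trans xa (ltW ay)).
Qed.

(* Convolution with box a b is integration from a, the fractional integral of order 1. *)
Definition box a b : R -> R := \1_`]0, (b - a)[.

Lemma box_le0 a b t : t <= 0 -> box a b t = 0.
Proof.
move=> t0; rewrite /box indicE memNset//= in_itv/=; apply/negP.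
by rewrite negb_and -leNgt t0.
Qed.

Lemma boxE a b t : 0 < t < b - a -> box a b t = 1.
Proof. by move=> tab; rewrite /box indicE mem_set//= in_itv. Qed.

Lemma intg_box a b : intg (box a b).
Proof. exact: integrable_indic_itv. Qed.

Lemma conv_box f a b x : intg f -> (forall y, y <= a -> f y = 0) -> a <= x <= b ->
  conv f (box a b) x = primitive f x.
Proof.
move=> fi f0 /andP[ax xb].
rewrite /primitive -Rintegral_itv_bndo_bndc; last exact: integrableS fi.
rewrite Rintegral_mkcond; apply: eq_Rintegral => y _; rewrite patchE.
case: ifPn; rewrite ?inE ?notin_setE/= in_itv/=; last first.
  by move/negP; rewrite -leNgt => xy; rewrite box_le0 ?mulr0// subr_le0.
move=> yx; have [ya|ay] := leP y a; first by rewrite f0// mul0r.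
by rewrite boxE ?mulr1//; lra.
Qed.

Variables (a b alpha : R) (U V : R -> R).
Hypotheses (ab : a < b) (alpha01 : 0 < alpha < 1).
Hypotheses (iU : intg U) (iV : intg V).
Hypothesis U0 : forall y, ~~ (a < y < b) -> U y = 0.
Hypothesis V0 : forall y, ~~ (a < y < b) -> V y = 0.

Let n1 := nker (1 - alpha) (b - a).
Let n2 := nker alpha (b - a).
Let k1 := box a b.

Let B0 : 0 < b - a. Proof. by rewrite subr_gt0. Qed.
Let in1 : intg n1.
Proof. by apply: intg_nker => //; rewrite subr_gt0; case/andP: alpha01. Qed.
Let in2 : intg n2.
Proof. by apply: intg_nker => //; case/andP: alpha01. Qed.
Let ik1 : intg k1. Proof. exact: intg_box. Qed.
Let Ua y : y <= a -> U y = 0.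
Proof. by move=> ya; rewrite U0// negb_and -leNgt ya. Qed.
Let Va y : y <= a -> V y = 0.
Proof. by move=> ya; rewrite V0// negb_and -leNgt ya. Qed.

(** Both sides of the weak identity become pairings of the derivative of phi with a convolution, of
    V with the box and of U with the kernel of order 1 - alpha, each with a minus sign. The
    difference of the two convolutions thus annihilates all such derivatives. *)
Lemma weak_primitive :
  (forall phi, test_function a b phi ->
     \int[mu]_x (V x * phi x) = \int[mu]_x (U x * frac_der_right b alpha phi x)) ->
  exists C, {ae mu, forall x, a < x < b -> conv U n1 x = C + primitive V x}.
Proof.
move=> weak.
have iUn := intg_conv iU in1; have iVk := intg_conv iV ik1.
have [|C aeC] := @ae_cst_of_test _ (fun x => conv U n1 x - conv V k1 x) a b ab (intgB iUn iVk).
  move=> phi tphi.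
  have [M hM] := test_function_bounded ab tphi.
  have [m0 m1] := test_function_measurable tphi.
  have d1 x : `|derive1 phi x| <= M by have [] := hM x.
  have [i1 e1] := conv_dual iU in1 m1 d1.
  have [i2 e2] := conv_dual iV ik1 m1 d1.
  have j1 := intgM_bounded m1 d1 iUn; have j2 := intgM_bounded m1 d1 iVk.
  transitivity (\int[mu]_x (derive1 phi x * conv U n1 x) -
                \int[mu]_x (derive1 phi x * conv V k1 x)).
    rewrite -(RintegralB measurableT j1 j2).
    by apply: eq_Rintegral => x _; rewrite mulrC mulrBr.
  rewrite e1 e2; apply/eqP; rewrite subr_eq0; apply/eqP.
  have NV : \int[mu]_y (V y * phi y) =
      - \int[mu]_y (V y * \int[mu]_x (derive1 phi x * k1 (x - y))).
    transitivity (\int[mu]_y (-1 * (V y * \int[mu]_x (derive1 phi x * k1 (x - y))))).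
      apply: eq_Rintegral => y _; have [yab|/V0 ->] := boolP (a < y < b).
        by rewrite (test_functionE yab tphi) !mulrN mulN1r opprK.
      by rewrite !mul0r mulr0.
    by rewrite (RintegralZlT (-1) (intg_measurable i2)) mulN1r.
  have NU : \int[mu]_y (U y * frac_der_right b alpha phi y) =
      - \int[mu]_y (U y * \int[mu]_x (derive1 phi x * n1 (x - y))).
    transitivity (\int[mu]_y (-1 * (U y * \int[mu]_x (derive1 phi x * n1 (x - y))))).
      apply: eq_Rintegral => y _; have [yab|/U0 ->] := boolP (a < y < b).
        by rewrite (frac_der_right_test yab (andP alpha01).2 tphi) -/n1 mulrN mulN1r.
      by rewrite !mul0r mulr0.
    by rewrite (RintegralZlT (-1) (intg_measurable i1)) mulN1r.
  apply: oppr_inj.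
  exact: (etrans (esym NU) (etrans (esym (weak _ tphi)) NV)).
exists C; apply: ae_imply aeC => x h axb; have /andP[ax xb] := axb.
rewrite -(conv_box (b := b) iV Va) ?(ltW ax) ?(ltW xb)//.
by rewrite -(h axb) subrK.
Qed.

(* Convolve the hypothesis with n2: as n1 * n2 = box on ]a - b, b - a[, it becomes
   an equality of primitives, which is then differentiated. *)
Lemma abel_inversion C :
  {ae mu, forall x, a < x < b -> conv U n1 x = C + primitive V x} ->
  {ae mu, forall x, a < x < b -> U x = C * n2 (x - a) + conv V n2 x}.
Proof.
move=> aeC.
(* [D] is the constant C made integrable by restriction to []a, b[]; [Q] is the kernel term of the
   claim. *)
pose D : R -> R := fun y => C * \1_`]a, b[ y.
pose Q : R -> R := fun y => D y * n2 (y - a).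
have iD : intg D by apply: intgZ; exact: integrable_indic_itv.
have mD := intg_measurable iD.
have iQ : intg Q.
  apply: (@intgM_bounded _ _ D `|C|) => //; last exact: (intg_shift (- a) in2).
  move=> y; rewrite /D normrM indicE.
  by case: (_ \in _); rewrite ?normr1 ?normr0 ?mulr1 ?mulr0.
have Dout y : ~~ (a < y < b) -> D y = 0.
  by move=> nab; rewrite /D indicE memNset ?mulr0//= in_itv/=; exact/negP.
have Din y : a < y < b -> D y = C.
  by move=> nab; rewrite /D indicE mem_set ?mulr1//= in_itv.
have Qa y : y <= a -> Q y = 0.
  by move=> ya; rewrite /Q Dout ?mul0r// negb_and -leNgt ya.
have iVn := intg_conv iV in2; have iUn := intg_conv iU in1.
have iVk := intg_conv iV ik1.
have [mn1 mn2 mk1] := And3 (intg_measurable in1) (intg_measurable in2) (intg_measurable ik1).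
have mV := intg_measurable iV.
have n2_le0 t : t <= 0 -> n2 t = 0 by exact: nker_le0.
have n1_le0 t : t <= 0 -> n1 t = 0 by exact: nker_le0.
have s1 x : a < x < b -> conv (conv U n1) n2 x = conv (fun y => D y + conv V k1 y) n2 x.
  move=> /andP[ax xb]; apply: eq_conv_left => //.
  - exact: intg_measurable.
  - by apply: measurable_funD => //; exact: intg_measurable.
  apply: ae_imply aeC => y h.
  have [xy|yx] := leP x y; first by left; rewrite n2_le0// subr_le0.
  have [ya|ay] := leP y a; right.
    rewrite (conv_left0 Ua n1_le0 ya) (conv_left0 Va (@box_le0 a b) ya) Dout ?addr0//.
    by rewrite negb_and -leNgt ya.
  have yab : a < y < b by rewrite ay (lt_trans yx).
  by rewrite h// Din// (conv_box (b := b) iV Va)// (ltW ay) ltW//; case/andP: yab.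
(* Only z in []a, b[] count, where x - z < b - a: the range in which the product of the two kernels
   is known. *)
have s2 x : a < x < b -> conv U (conv n1 n2) x = conv U k1 x.
  move=> /andP[ax xb]; apply: eq_Rintegral => z _.
  have [/andP[az zb]|/U0 ->] := boolP (a < z < b); last by rewrite !mul0r.
  congr (_ * _); rewrite conv_nker_complement//.
  case: ifPn => xz; last by rewrite /k1 box_le0// leNgt.
  by rewrite ifT /k1 ?boxE ?xz//=; lra.
(* The reflection y -> a + x - y turns the kernel in x - y into the kernel in y - a and preserves
   the constant on []a, x[]. *)
have s3 x : a < x < b -> conv D n2 x = conv Q k1 x.
  move=> /andP[ax xb]; rewrite /conv -(Rintegral_reflect (a + x)); last first.
    by apply: measurable_funM => //; exact: measurable_reflect.
  apply: eq_Rintegral => y _; rewrite (_ : x - (a + x - y) = y - a); last by ring.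
  have [ya|ay] := leP y a; first by rewrite (Qa _ ya) mul0r n2_le0 ?mulr0// subr_le0.
  rewrite /Q [RHS]mulrAC; congr (_ * _).
  have [xy|yx] := leP x y.
    rewrite /k1 box_le0 ?subr_le0// mulr0 Dout// negb_and -leNgt.
    by apply/orP; left; lra.
  rewrite Din; last by apply/andP; split; lra.
  rewrite Din; last by rewrite ay (lt_trans yx).
  by rewrite /k1 boxE ?mulr1//; apply/andP; split; lra.
have A1 := convA iU in1 in2.
have A2 := convA iV ik1 in2.
have A3 := convA iV in2 ik1.
have A4 := ae_convD iD iVk in2.
have iUQ := intgB iU iQ.
have A5 := ae_convB iUQ iVn ik1.
have A6 := ae_convB iU iQ ik1.
pose Z z := U z - Q z - conv V n2 z.
have iZ : intg Z := intgB iUQ iVn.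
have Za z : z <= a -> Z z = 0.
  by move=> za; rewrite /Z Ua// Qa// (conv_left0 Va n2_le0 za) !subr0.
suff prim0 : {ae mu, forall x, a < x < b -> primitive Z x = 0}.
  apply: ae_imply (primitive_ae0 iZ ab prim0) => x h axb.
  have /eqP := h axb; rewrite /Z /Q Din//.
  by rewrite subr_eq0 subr_eq addrC => /eqP.
have A12 := ae_imply2 (fun x h1 h2 => conj h1 h2) A1 A2.
have A34 := ae_imply2 (fun x h1 h2 => conj h1 h2) A3 A4.
have A56 := ae_imply2 (fun x h1 h2 => conj h1 h2) A5 A6.
have A1234 := ae_imply2 (fun x h1 h2 => conj h1 h2) A12 A34.
apply: (ae_imply2 _ A1234 A56) => x [[h1 h2] [h3 h4]] [h5 h6] axb.
have axb' : a <= x <= b by case/andP: axb => ? ?; rewrite !ltW.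
have hZ : conv Z k1 x = _ := h5.
(* The chain is U * k1 = U * (n1 * n2) = (U * n1) * n2 = (D + V * k1) * n2 = Q * k1 + (V * n2) * k1,
   at almost every x. *)
rewrite -(conv_box iZ Za axb') -/k1 hZ h6 -(s2 x axb) -h1 (s1 x axb) h4 (s3 x axb) h2.
have -> : conv k1 n2 = conv n2 k1 by apply/funext => z; exact: convC.
by rewrite -h3 addrAC addrK subrr.
Qed.

End left_case.

(** * The representation formula on the left *)

Section left_representation.
Context {R : realType}.
Local Notation mu := (@lebesgue_measure R).
Local Notation intg f := (mu.-integrable setT (EFin \o f)).
Implicit Types (f g h u v : R -> R) (a b x p e alpha : R).

(** On []a, b[] the bound |f| <= 1 + |f|^p holds, and the constant 1 is integrable since the
    interval is bounded. *)
Lemma in_Lp_intg a b p f : 1 <= p -> in_Lp a b p f -> intg (f \_ `]a, b[).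
Proof.
move=> p1 fp; set F := f \_ `]a, b[.
have mF : measurable_fun setT F.
  by move: fp; rewrite /in_Lp inE => /andP[]; rewrite inE.
have iFp := Lfun_integrable p1 fp.
have i1 : intg (\1_`]a, b[ : R -> R) by exact: integrable_indic_itv.
have iS : intg (fun x => \1_`]a, b[ x + `|F x| `^ p) by exact: intgD i1 iFp.
apply: (le_intg mF _ iS) => x.
rewrite [leRHS]ger0_norm ?addr_ge0 ?powR_ge0//.
rewrite /F patchE indicE; case: ifPn => xab; last first.
  by rewrite normr0 add0r powR_ge0.
have [f1|f1] := leP `|f x| 1; first by rewrite (le_trans f1)// lerDl powR_ge0.
by rewrite (le_trans (le1r_powR (ltW f1) p1))// lerDr.
Qed.

Lemma absolutely_continuous_right a b g e : a < b -> absolutely_continuous a b g ->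
  0 < e -> exists2 d, 0 < d & forall x, a < x < b -> x < a + d -> `|g x - g a| < e.
Proof.
move=> ab acg e0; have [d d0 hd] := acg _ e0; exists d => // x /andP[ax xb] xd.
have := hd 1%N (fun=> a) (fun=> x); rewrite !big_ord_recl !big_ord0 !addr0; apply.
- by move=> _; rewrite ax lexx ltW.
- by apply/trivIsetP => i j _ _; rewrite !ord1 eqxx.
- by rewrite ltrBlDl.
Qed.

(** Equality almost everywhere says nothing at a itself, but it yields points just to the right of a
    where g and h agree, and both are right-continuous at a. Hence the endpoint constant does not
    depend on the representative. *)
Lemma ac_ae_eq_left_endpoint a b g h : a < b ->
  absolutely_continuous a b g -> absolutely_continuous a b h ->
  {ae mu, forall x, a < x < b -> g x = h x} -> g a = h a.
Proof.
move=> ab acg ach gh; apply/eqP; rewrite -subr_eq0 -normr_le0.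
apply/ler_addgt0Pl => e e0; rewrite addr0.
have e20 : 0 < e / 2 by rewrite divr_gt0.
have [d1 d10 h1] := absolutely_continuous_right ab acg e20.
have [d2 d20 h2] := absolutely_continuous_right ab ach e20.
have am : a < Num.min b (Num.min (a + d1) (a + d2)).
  by rewrite !lt_min ab !ltrDl d10 d20.
have [x /andP[ax + ] ghx] := ae_exists_itv am gh.
rewrite !lt_min => /and3P[xb xd1 xd2].
have axb : a < x < b by rewrite ax.
have := h1 x axb xd1; have := h2 x axb xd2; rewrite (ghx axb).
set gx := h x => k2 k1; rewrite -(subrKA gx) (le_trans (ler_normD _ _))//.
by rewrite (splitr e) lerD ?(ltW k2)// distrC ltW.
Qed.

Lemma left_representation a b alpha u v : a < b -> 0 < alpha < 1 ->
  intg (u \_ `]a, b[) -> intg (v \_ `]a, b[) ->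
  (forall phi, test_function a b phi ->
    \int[mu]_(x in `]a, b[) (v x * phi x) =
    \int[mu]_(x in `]a, b[) (u x * frac_der_right b alpha phi x)) ->
  (exists g, ac_representative a b (frac_int_left a (1 - alpha) u) g) /\
  (forall g, ac_representative a b (frac_int_left a (1 - alpha) u) g ->
     ae_eq mu `]a, b[%classic u
       (fun x => g a / Gamma alpha * kernel_left a alpha x + frac_int_left a alpha v x)).
Proof.
move=> ab alpha01 iU iV weak.
set U := u \_ `]a, b[; set V := v \_ `]a, b[.
have out f y : ~~ (a < y < b) -> (f \_ `]a, b[) y = 0.
  by move=> yab; rewrite patchE memNset//= in_itv/=; exact/negP.
have inside f y : a < y < b -> (f \_ `]a, b[) y = f y.
  by move=> yab; rewrite patchE mem_set//= in_itv.
have Va y : y <= a -> V y = 0 by move=> ya; rewrite /V out// negb_and -leNgt ya.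
have [|C aeC] := weak_primitive ab alpha01 iU iV (out u) (out v).
  move=> phi tphi; have := weak phi tphi.
  rewrite Rintegral_mkcond [RHS]Rintegral_mkcond => eqw.
  transitivity (\int[mu]_x ((fun x => v x * phi x) \_ `]a, b[) x).
    by apply: eq_Rintegral => x _; rewrite !patchE; case: ifP; rewrite ?mul0r.
  rewrite eqw.
  by apply: eq_Rintegral => x _; rewrite !patchE; case: ifP; rewrite ?mul0r.
have inv := abel_inversion ab alpha01 iU iV (out u) (out v) aeC.
have acV := primitive_absolutely_continuous a b C iV.
have fracE : {ae mu, forall x, a < x < b ->
    frac_int_left a (1 - alpha) u x = C + primitive V x}.
  apply: ae_imply aeC => x h axb.
  by rewrite (frac_int_leftE _ (intg_measurable iU) axb) h.
have toD (P : R -> Prop) : {ae mu, forall x, a < x < b -> P x} ->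
    {ae mu, forall x, (`]a, b[%classic : set R) x -> P x}.
  by apply: ae_imply => x h; rewrite /= in_itv.
split; first by exists (fun x => C + primitive V x); split => //; exact: toD.
(* The representative [C + primitive V] has value C at a, and every other representative shares this
   value. *)
move=> g [acg aeg]; have ga : g a = C.
  rewrite (ac_ae_eq_left_endpoint ab acg acV) /=.
    rewrite /primitive (_ : \int[mu]_(t in _) _ = \int[mu]_(t in `]-oo, a]) (0 : R)).
      by rewrite Rintegral_cst// mul0r addr0.
    by apply: eq_Rintegral => t; rewrite inE/= in_itv/= => /Va.
  apply: (ae_imply2 _ fracE aeg) => x h1 h2 axb.
  by rewrite -h1// h2//= in_itv.
apply: toD; apply: ae_imply inv => x h axb; have /andP[ax xb] := axb.
rewrite -(inside u x axb) h// (frac_int_leftE _ (intg_measurable iV) axb) ga.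
congr (_ + _); rewrite /nker /trunc_pker /pker /kernel_left ifT; last by lra.
by rewrite subr_gt0 ax mulrA.
Qed.

End left_representation.

(** * Reflection *)

Section reflection.
Context {R : realType}.
Local Notation mu := (@lebesgue_measure R).
Local Notation intg f := (mu.-integrable setT (EFin \o f)).
Implicit Types (f g u v phi : R -> R) (a b c s x alpha : R).

Lemma ae_reflect c (P : R -> Prop) : {ae mu, forall x, P x} ->
  {ae mu, forall x, P (c - x)}.
Proof.
move=> [N [mN N0 sub]].
have mphi : measurable_fun setT (fun x : R => c - x).
  by apply: measurable_funB => //; exact: measurable_id.
have mN' : measurable ((fun x : R => c - x) @^-1` N).
  by rewrite -[X in measurable X]setTI; exact: mphi.
exists ((fun x => c - x) @^-1` N); split => //; last by move=> x /= nP; exact: sub.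
transitivity (\int[mu]_x (\1_N (c - x))%:E)%E.
  by rewrite -[X in mu X]setIT -integral_indic.
rewrite (ge0_integral_reflect c (f := fun x => (\1_N x)%:E))//.
  by rewrite integral_indic// setIT.
by apply/measurable_EFinP.
Qed.

Lemma restrict_reflect a b f :
  (fun x => f (a + b - x)) \_ `]a, b[ = (fun x => (f \_ `]a, b[) (a + b - x)).
Proof.
apply/funext => x; rewrite !patchE.
rewrite (_ : (a + b - x \in `]a, b[%classic) = (x \in `]a, b[%classic))//.
by apply/idP/idP; rewrite !inE/= !in_itv/= => /andP[? ?]; apply/andP; split; lra.
Qed.

Lemma frac_int_reflect a b s f x : measurable_fun setT (f \_ `]a, b[) -> a < x < b ->
  frac_int_right b s f x = frac_int_left a s (fun y => f (a + b - y)) (a + b - x).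
Proof.
move=> mf /[dup] axb /andP[ax xb].
have mf' : measurable_fun setT ((fun y => f (a + b - y)) \_ `]a, b[).
  by rewrite restrict_reflect; exact: measurable_reflect.
rewrite (frac_int_rightE _ mf axb) (frac_int_leftE _ mf'); last first.
  by apply/andP; split; lra.
have mn : measurable_fun setT (nker s (b - a)).
  by apply: measurable_funM => //; exact: measurable_trunc_pker.
rewrite /conv restrict_reflect.
rewrite -[LHS](Rintegral_reflect (a + b)); last first.
  by apply: measurable_funM => //; exact: (measurable_shift (- x)).
by apply: eq_Rintegral => y _; congr (_ * nker _ _ _); ring.
Qed.

Lemma test_function_reflect a b phi : test_function a b phi ->
  test_function a b (fun x => phi (a + b - x)).
Proof.
move=> [dphi cpt supp].
have cr : continuous (fun x : R => a + b - x).
  by move=> x; apply: cvgB; [exact: cvg_cst|exact: cvg_id].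
have supp' : closure [set x | phi (a + b - x) != 0] `<=`
    (fun x => a + b - x) @^-1` closure [set x | phi x != 0].
  move=> x cx B /cr nB.
  by have [y [hy1 hy2]] := cx _ nB; exists (a + b - y).
have sub : closure [set x | phi (a + b - x) != 0] `<=` `]a, b[.
  move=> x /supp' /= /supp; rewrite /= !in_itv/= => /andP[? ?].
  by apply/andP; split; lra.
split => //.
- move=> n x; apply: diffn_derivable.
  have := diffn_affine (-1) (a + b) (derivable_diffn n.+1 dphi).
  by congr diffn; apply/funext => y; rewrite mulN1r addrC.
- apply: (@subclosed_compact _ _ `[a, b]%classic); first exact: closed_closure.
    exact: segment_compact.
  by move=> x /sub/=; rewrite !in_itv/= => /andP[? ?]; rewrite !ltW.
Qed.

(** The factor -1 of the chain rule is the minus sign in the definition of the right derivative.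
    Differentiability of the fractional integral comes from [is_derive_conv_reflect]. *)
Lemma frac_der_reflect a b alpha phi x : a < x < b -> alpha < 1 ->
  test_function a b phi ->
  frac_der_left a alpha (fun y => phi (a + b - y)) x =
  frac_der_right b alpha phi (a + b - x).
Proof.
move=> axb a1 tphi; have ab : a < b by case/andP: axb => /lt_trans; apply.
have raxb z : a < z < b -> a < a + b - z < b.
  by move=> /andP[? ?]; apply/andP; split; lra.
have ik : intg (nker (1 - alpha) (b - a)) by apply: intg_nker; rewrite subr_gt0.
have mr : measurable_fun setT (phi \_ `]a, b[).
  by rewrite restrict_test_function//; have [] := test_function_measurable tphi.
have dr : is_derive x 1 (fun z : R => a + b - z) (-1).
  rewrite -[X in is_derive _ _ _ X](add0r (-1)).
  by apply: is_deriveB.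
have d := is_derive_conv_reflect (a + b - x) ab tphi ik.
have dc := @is_derive1_comp _ _ (fun z : R => a + b - z) x _ _ d dr.
have ne : \forall z \near x,
    ((fun z => \int[mu]_y (phi y * nker (1 - alpha) (b - a) (y - z))) \o
     (fun z : R => a + b - z)) z =
    frac_int_left a (1 - alpha) (fun y => phi (a + b - y)) z.
  have : \forall z \near x, z \in `]a, b[ by apply: near_in_itvoo; rewrite in_itv.
  apply: filterS => z; rewrite in_itv/= => azb.
  have := frac_int_reflect (1 - alpha) mr (raxb z azb).
  rewrite subKr => <-.
  by rewrite (frac_int_rightE _ mr (raxb z azb)) restrict_test_function.
have d' := near_eq_is_derive ne dc.
rewrite /frac_der_left derive1E derive_val (frac_der_right_test (raxb x axb) a1 tphi).
by rewrite mulrN1.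
Qed.

Lemma absolutely_continuous_reflect a b g : absolutely_continuous a b g ->
  absolutely_continuous a b (fun x => g (a + b - x)).
Proof.
move=> acg e e0; have [d d0 hd] := acg e e0; exists d => // n l r lr tF sd.
under eq_bigr do rewrite distrC.
apply: (hd n (fun i => a + b - r i) (fun i => a + b - l i)).
- by move=> i; have [? ? ?] := lr i; split; lra.
- apply/trivIsetP => i j _ _ ij; rewrite -subset0 => x [/=].
  rewrite !in_itv/= => /andP[? ?] /andP[? ?].
  have /trivIsetP/(_ i j I I ij) := tF.
  rewrite -subset0 => /(_ (a + b - x)); apply.
  by split; rewrite /= in_itv/=; apply/andP; split; lra.
- by rewrite (eq_bigr (fun i => r i - l i))// => i _; ring.
Qed.

Lemma right_representation a b alpha u v : a < b -> 0 < alpha < 1 ->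
  intg (u \_ `]a, b[) -> intg (v \_ `]a, b[) ->
  (forall phi, test_function a b phi ->
    \int[mu]_(x in `]a, b[) (v x * phi x) =
    \int[mu]_(x in `]a, b[) (u x * frac_der_left a alpha phi x)) ->
  (exists g, ac_representative a b (frac_int_right b (1 - alpha) u) g) /\
  (forall g, ac_representative a b (frac_int_right b (1 - alpha) u) g ->
     ae_eq mu `]a, b[%classic u
       (fun x => g b / Gamma alpha * kernel_right b alpha x + frac_int_right b alpha v x)).
Proof.
move=> ab alpha01 iU iV weak; have a1 := (andP alpha01).2.
pose ru x := u (a + b - x); pose rv x := v (a + b - x).
have irU : intg (ru \_ `]a, b[) by rewrite restrict_reflect; exact: intg_reflect.
have irV : intg (rv \_ `]a, b[) by rewrite restrict_reflect; exact: intg_reflect.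
have raxb z : a < z < b -> a < a + b - z < b.
  by move=> /andP[? ?]; apply/andP; split; lra.
have inside f y : a < y < b -> (f \_ `]a, b[) y = f y.
  by move=> yab; rewrite patchE mem_set//= in_itv.
have out f y : ~~ (a < y < b) -> (f \_ `]a, b[) y = 0.
  by move=> yab; rewrite patchE memNset//= in_itv/=; exact/negP.
have restrM f g : \int[mu]_(x in `]a, b[) (f x * g x) = \int[mu]_x ((f \_ `]a, b[) x * g x).
  rewrite Rintegral_mkcond; apply: eq_Rintegral => x _.
  by rewrite !patchE; case: ifP; rewrite ?mul0r.
have weak' phi : test_function a b phi ->
    \int[mu]_(x in `]a, b[) (rv x * phi x) =
    \int[mu]_(x in `]a, b[) (ru x * frac_der_right b alpha phi x).
  move=> tphi; have := weak _ (test_function_reflect tphi).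
  have [m0 m1] := test_function_measurable tphi.
  have [M hM] := test_function_bounded ab tphi.
  have ik : intg (nker (1 - alpha) (b - a)) by apply: intg_nker; rewrite subr_gt0.
  have [iD _] := conv_dual irU ik m1 (fun x => (hM x).2).
  (* Reflecting an integral requires a measurable integrand on the whole line. [m] has the
     fractional derivative replaced by its convolution formula, valid on []a, b[], and its
     measurability follows from the integrability given by [conv_dual]. *)
  pose m x := (ru \_ `]a, b[) x * - \int[mu]_y (derive1 phi y * nker (1 - alpha) (b - a) (y - x)).
  have mm : measurable_fun setT m.
    rewrite (_ : m = fun x => -1 * ((ru \_ `]a, b[) x *
      \int[mu]_y (derive1 phi y * nker (1 - alpha) (b - a) (y - x)))).
      by apply: measurable_funM => //; exact: intg_measurable iD.
    by apply/funext => x; rewrite /m mulrN mulN1r.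
  have -> : \int[mu]_(x in `]a, b[) (v x * phi (a + b - x)) =
      \int[mu]_(x in `]a, b[) (rv x * phi x).
    rewrite !restrM -[RHS](Rintegral_reflect (a + b)); last first.
      by apply: measurable_funM => //; exact: intg_measurable irV.
    by apply: eq_Rintegral => x _; rewrite restrict_reflect subKr.
  move=> ->; transitivity (\int[mu]_x m x).
    rewrite restrM -[RHS](Rintegral_reflect (a + b) mm); apply: eq_Rintegral => x _.
    rewrite /m restrict_reflect subKr.
    have [axb|/out ->] := boolP (a < x < b); last by rewrite !mul0r.
    by rewrite frac_der_reflect// (frac_der_right_test (raxb x axb) a1 tphi).
  rewrite restrM; apply: eq_Rintegral => x _; rewrite /m.
  have [axb|/out ->] := boolP (a < x < b); last by rewrite !mul0r.
  by rewrite (frac_der_right_test axb a1 tphi).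
have [[g' [acg' aeg']] uniq] := left_representation ab alpha01 irU irV weak'.
have toI (P : R -> Prop) : {ae mu, forall x, (`]a, b[%classic : set R) x -> P x} ->
    {ae mu, forall x, a < x < b -> P x}.
  by apply: ae_imply => x + axb; apply; rewrite /= in_itv.
have toD (P : R -> Prop) : {ae mu, forall x, a < x < b -> P x} ->
    {ae mu, forall x, (`]a, b[%classic : set R) x -> P x}.
  by apply: ae_imply => x h; rewrite /= in_itv.
have mU := intg_measurable iU; have mV := intg_measurable iV.
split.
  exists (fun x => g' (a + b - x)); split; first exact: absolutely_continuous_reflect.
  apply: toD; apply: ae_imply (ae_reflect (a + b) (toI _ aeg')) => x h axb.
  by rewrite (frac_int_reflect _ mU axb) h// raxb.
move=> g [acg aeg].
have rep : ac_representative a b (frac_int_left a (1 - alpha) ru) (fun x => g (a + b - x)).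
  split; first exact: absolutely_continuous_reflect.
  apply: toD; apply: ae_imply (ae_reflect (a + b) (toI _ aeg)) => x h axb.
  have := frac_int_reflect (1 - alpha) mU (raxb x axb); rewrite subKr => <-.
  by rewrite h// raxb.
have := uniq _ rep; rewrite (_ : a + b - a = b); last by ring.
move=> /toI/(ae_reflect (a + b)) aeu; apply: toD; apply: ae_imply aeu => x h axb.
have := h (raxb x axb); rewrite /ru subKr => ->.
rewrite (frac_int_reflect _ mV axb); congr (_ * _ `^ _ + _).
by ring.
Qed.

End reflection.

(** The endpoint constant is formed with an arbitrary absolutely continuous representative g; the
    existence clause keeps the universal one from being vacuous. *)
Theorem theorem4p5 (R : realType) (a b alpha p : R) (u v : R -> R)
    (hab : a < b) (halpha0 : 0 < alpha) (halpha1 : alpha < 1) (hp : 1 <= p)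
    (hu : in_Lp a b p u) (hv : in_Lp a b p v) :
  (weak_frac_der_left a b alpha u v ->
     (exists g : R -> R, ac_representative a b (frac_int_left a (1 - alpha) u) g) /\
     (forall g : R -> R, ac_representative a b (frac_int_left a (1 - alpha) u) g ->
        ae_eq (@lebesgue_measure R) `]a, b[%classic u
          (fun x : R => g a / Gamma alpha * kernel_left a alpha x
                    + frac_int_left a alpha v x))) /\
  (weak_frac_der_right a b alpha u v ->
     (exists g : R -> R, ac_representative a b (frac_int_right b (1 - alpha) u) g) /\
     (forall g : R -> R, ac_representative a b (frac_int_right b (1 - alpha) u) g ->
        ae_eq (@lebesgue_measure R) `]a, b[%classic u
          (fun x : R => g b / Gamma alpha * kernel_right b alpha x
                    + frac_int_right b alpha v x))).
Proof.
have alpha01 : 0 < alpha < 1 by rewrite halpha0.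
have iU := in_Lp_intg hp hu; have iV := in_Lp_intg hp hv.
split=> [[_ _ weak]|[_ _ weak]].
- exact: left_representation.
- exact: right_representation.
Qed.
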